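(* For every $n\in\mathbb N$, as formal power series in $X$ with coefficients in $\mathbb Z[Y,\mathbf x]$, \[ \mathsf H_n(Y;\mathbf x,X)\,(1-X)=\mathsf{HLS}_n\bigl(Y,(\mathbf x_CX)_{\varnothing\neq C\subseteq[n]}\bigr). \] In particular $\mathsf H_n(Y;\mathbf x,X)=\mathsf H^{\mathrm{num}}_n(Y,\mathbf x,X)/\prod_{I\subseteq[n]}(1-\mathbf x_IX)$ with \[ \mathsf H^{\mathrm{num}}_n(Y,\mathbf x,X)=\sum_{T\in\mathrm{rSSYT}_n}\Phi_T(Y)\prod_{C\in T}\mathbf x_CX\prod_{\varnothing\neq I\subseteq[n],\,I\notin T}(1-\mathbf x_IX)\in\mathbb Z[Y,\mathbf x,X]. \] (Taking $Y=q^{-1}$, $\mathsf H_n$ is Macdonald's Fourier-transformed Hecke series for $\mathrm{GSp}_{2n}$ over a local field with residue cardinality $q$.)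
   Context: Hall–Littlewood–Schubert series: Let $[n]=\{1,\dots,n\}$. $\mathrm{SSYT}_n$ is the set of semistandard Young tableaux with entries in $[n]$ (including the empty one); a tableau is identified with its sequence of columns $(C_1,\dots,C_\ell)$, $C_j\subseteq[n]$ the set of entries of column $j$, and $T_{ij}$ is the entry in row $i$, column $j$. $T$ is reduced if its columns are pairwise distinct; $\mathrm{rSSYT}_n$ is the finite set of reduced tableaux. For cells $(i,j),(i,j+1)$ both in $T$, $\mathrm{Leg}^+_T(i,j)=C_j\cap\{T_{ij},\dots,T_{i,j+1}\}$ if $T_{i,j+1}\notin C_j$, else $\varnothing$ ($\varnothing$ if a cell is missing). $\Phi_T(Y)=\prod_{\mathrm{Leg}^+_T(i,j)\neq\varnothing}(1-Y^{\#\mathrm{Leg}^+_T(i,j)})$. For variables $\mathbf X=(X_C)_{\varnothing\ne C\subseteq[n]}$, $\mathsf{HLS}_n(Y,\mathbf X)=\sum_{T\in\mathrm{rSSYT}_n}\Phi_T(Y)\prod_{C\in T}\frac{X_C}{1-X_C}$; $\mathsf{HLS}_n(Y,(f_C)_C)$ denotes the substitution $X_C\mapsto f_C$. Variables $\mathbf x=(x_1,\dots,x_n)$, $X$; $\mathbf x_C=\prod_{i\in C}x_i$ ($\mathbf x_\varnothing=1$). For a partition $\lambda$ with at most $n$ parts, $P_\lambda(\mathbf x;t)$ is the Hall–Littlewood polynomial $P_\lambda(\mathbf x;t)=\frac{1}{v_\lambda(t)}\sum_{w\in S_n}w\bigl(x_1^{\lambda_1}\cdots x_n^{\lambda_n}\prod_{i<j}\frac{x_i-tx_j}{x_i-x_j}\bigr)$,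 where $v_\lambda(t)=\prod_{m\ge0}\prod_{i=1}^{m_i'}\frac{1-t^i}{1-t}$ with $m_i'$ ranging over multiplicities: precisely $v_\lambda(t)=\prod_{m\ge0}\prod_{i=1}^{\#\{k:\lambda_k=m\}}\frac{1-t^i}{1-t}$ (parts $\lambda_k$, $k\in[n]$, zeros included). Define $\mathsf H_n(Y;\mathbf x,X)=\frac{1}{1-X}\sum_{\lambda}P_\lambda(\mathbf x;Y)X^{\lambda_1}$, the sum over all partitions with at most $n$ parts. *)

(* Defs.v *)
From HB Require Import structures.
From mathcomp Require Import all_boot all_order all_algebra all_fingroup.
From mathcomp Require Import fraction mpoly.
Set Implicit Arguments. Unset Strict Implicit. Unset Printing Implicit Defensive.
Import Order.TTheory GRing.Theory Num.Theory.
Local Open Scope ring_scope.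

(* Coefficient ring.  Z[Y, x_1, ..., x_n] is {mpoly int[n.+1]}, where  *)
(* variable 0 is Y and variable (lift ord0 i) is x_(i+1).  We work in   *)
(* its field of fractions K (needed for the division in the definition *)
(* of Hall-Littlewood polynomials); Z[Y,x][[X]] embeds in K[[X]].       *)
Definition Zpoly (n : nat) := {mpoly int[n.+1]}.
Definition K (n : nat) := {fraction (Zpoly n)}.
Definition tofracK (n : nat) (p : Zpoly n) : K n := @FracField.tofrac (Zpoly n) p.

Definition varY (n : nat) : K n := tofracK ('X_ord0 : Zpoly n).
Definition varx (n : nat) (i : 'I_n) : K n := tofracK ('X_(lift ord0 i) : Zpoly n).

Definition xC (n : nat) (C : {set 'I_n}) : K n := \prod_(i in C) varx i.

Definition fps (R : Type) := nat -> R.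

Definition fps_mul (R : pzRingType) (f g : fps R) : fps R :=
  fun k => \sum_(i < k.+1) f i * g (k - i)%N.
Definition fps_one (R : pzRingType) : fps R := fun k => (k == 0)%:R.
Definition fps_geom (R : pzRingType) (a : R) : fps R := fun k => a ^+ k.
Definition fps_monX (R : pzRingType) (a : R) : fps R :=
  fun k => if k == 1%N then a else 0.
Definition fps_1m (R : pzRingType) (a : R) : fps R :=
  fun k => if k == 0%N then 1 else if k == 1%N then - a else 0.
(* the series X_C/(1 - X_C) after the substitution X_C := a X *)
Definition fps_frac (R : pzRingType) (a : R) : fps R :=
  fps_mul (fps_monX a) (fps_geom a).

(* A partition with at most n parts is a nonincreasing lam : 'I_n -> nat*)
(* (zero parts included); lam_1 = max_i lam i (= 0 when n = 0).         *)
Definition nonincr (n : nat) (lam : 'I_n -> nat) : bool :=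
  [forall i : 'I_n, forall j : 'I_n, (i <= j)%N ==> (lam j <= lam i)%N].

Definition lam1 (n : nat) (lam : 'I_n -> nat) : nat := \max_(i < n) lam i.

(* v_lam(t) = prod_{m >= 0} prod_{i=1}^{#{k : lam_k = m}} (1 - t^i)/(1 - t);
   only m <= lam_1 contribute. *)
Definition v_lam (n : nat) (F : fieldType) (lam : 'I_n -> nat) (t : F) : F :=
  \prod_(m < (lam1 lam).+1)
     \prod_(i < #|[set k : 'I_n | lam k == m]|) ((1 - t ^+ i.+1) / (1 - t)).

Definition HL_P (n : nat) (lam : 'I_n -> nat) (t : K n) : K n :=
  (v_lam lam t)^-1 *
  \sum_(w : 'S_n)
     ((\prod_(i < n) varx (w i) ^+ lam i) *
      \prod_(i < n) \prod_(j < n | (i < j)%N)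
         ((varx (w i) - t * varx (w j)) / (varx (w i) - varx (w j)))).

Definition HL_series (n : nat) : fps (K n) :=
  fun k => \sum_(lam : {ffun 'I_n -> 'I_k.+1} |
                   nonincr (fun i => val (lam i)) && (lam1 (fun i => val (lam i)) == k))
              HL_P (fun i => val (lam i)) (varY n).

Definition H_n (n : nat) : fps (K n) := fps_mul (fps_geom (1 : K n)) (HL_series n).

(* Semistandard Young tableaux with entries in [n] (entries are         *)
(* encoded as elements of 'I_n, i.e. shifted by one), given as the      *)
(* sequence of their columns C_1, ..., C_l (sets of entries).           *)
Definition tableau (n : nat) := seq {set 'I_n}.

Definition col (n : nat) (T : tableau n) (j : nat) : {set 'I_n} := nth set0 T j.
(* entries of a column, increasing from top to bottom *)
Definition colseq (n : nat) (C : {set 'I_n}) : seq nat := [seq val i | i <- enum C].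
(* T_{ij} (0-based row i, column j) *)
Definition cell (n : nat) (T : tableau n) (i j : nat) : nat := nth 0%N (colseq (col T j)) i.
Definition in_T (n : nat) (T : tableau n) (i j : nat) : bool :=
  (j < size T)%N && (i < #|col T j|)%N.

Definition is_SSYT (n : nat) (T : tableau n) : bool :=
  all (fun C => C != set0) T &&
  all (fun j => (#|col T j.+1| <= #|col T j|)%N &&
                all (fun i => (cell T i j <= cell T i j.+1)%N) (iota 0 #|col T j.+1|))
      (iota 0 (size T).-1).

Definition is_rSSYT (n : nat) (T : tableau n) : bool := is_SSYT T && uniq T.

Definition legp (n : nat) (T : tableau n) (i j : nat) : {set 'I_n} :=
  if in_T T i j && in_T T i j.+1 && (cell T i j.+1 \notin colseq (col T j))
  then [set k in col T j | (cell T i j <= val k <= cell T i j.+1)%N]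
  else set0.

Definition PhiT (n : nat) (R : pzRingType) (T : tableau n) (Y : R) : R :=
  \prod_(j < size T) \prod_(i < n | legp T i j != set0) (1 - Y ^+ #|legp T i j|).

(* Sum over rSSYT_n: a reduced tableau has distinct nonempty columns, so at
   most 2^n - 1 of them; we sum over lengths l <= 2^n and l-tuples. *)

Definition HLS_subst (n : nat) : fps (K n) :=
  fun k => \sum_(l < (2 ^ n).+1) \sum_(T : l.-tuple {set 'I_n} | is_rSSYT (val T))
     PhiT (val T) (varY n) *
     (\big[@fps_mul (K n)/@fps_one (K n)]_(C <- val T) fps_frac (xC C)) k.

Definition Hnum (n : nat) : fps (K n) :=
  fun k => \sum_(l < (2 ^ n).+1) \sum_(T : l.-tuple {set 'I_n} | is_rSSYT (val T))
     PhiT (val T) (varY n) *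
     fps_mul (\big[@fps_mul (K n)/@fps_one (K n)]_(C <- val T) fps_monX (xC C))
             (\big[@fps_mul (K n)/@fps_one (K n)]_(I : {set 'I_n} | (I != set0) && (I \notin val T))
                 fps_1m (xC I)) k.

(* Main.v *)
(* Grouped by columns, the weight of a tableau is a product over consecutive
   columns C, D of the factors 1 - t^m, one for each d in D \ C, where
   m = #{e in C, e < d} - #{e in D, e < d}; this product vanishes unless C, D may
   be neighbours in a semistandard tableau.  Let B_C be the sum over all tableaux
   with prescribed column sizes that may follow the column C.  By induction on the
   number of columns, B_C is symmetric in x_i, x_{i+1} when C contains both or
   neither of i, i+1, and exchanging i + 1 for i in C acts on B_C by a
   Demazure-Lusztig operator: this is the relation T X_i T = t X_{i+1} of the affine
   Hecke algebra.  Hence the functional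
     rho g = sum_w g(x_w) prod_{j < i} (x_{w i} - t x_{w j}) / (x_{w i} - x_{w j})
   multiplies x_D B_D by t at each such exchange.  Moving every column D to the
   last #D positions costs a q-binomial coefficient per column, and these multiply
   to rho(1) / v_lambda, so B_[n] is the Hall-Littlewood polynomial.  Finally a
   maximal run of equal columns C contributes X_C / (1 - X_C). *)
Require Import Defs.
From HB Require Import structures.
From mathcomp Require Import all_boot all_order all_algebra all_fingroup.
From mathcomp Require Import fraction mpoly ring zify.
From Stdlib Require Import FunctionalExtensionality.
Set Implicit Arguments. Unset Strict Implicit. Unset Printing Implicit Defensive.
Import Order.TTheory GRing.Theory Num.Theory.
Local Open Scope ring_scope.

(** * Column-by-column tableau sums and their Hecke symmetry *)

Lemma card_ltn_ord (n c : nat) : (c <= n)%N -> #|[set i : 'I_n | (i < c)%N]| = c.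
Proof.
move=> cn; rewrite -sum1_card -[RHS]card_ord -sum1_card (big_ord_widen n (fun=> 1%N) cn).
by apply: eq_bigl => i; rewrite inE.
Qed.

Section Columns.
Variables (F : fieldType) (n : nat) (t : F).
Hypothesis t_neq0 : t != 0.
Implicit Types (C D : {set 'I_n}) (x : 'I_n -> F) (l : seq nat).

Definition below C (d : nat) : nat := #|[set e in C | (e < d)%N]|.

Lemma below_succ C (i : 'I_n) : below C i.+1 = (below C i + (i \in C))%N.
Proof.
rewrite /below -(cardID (pred1 i)) addnC; congr addn.
  apply: eq_card => e; rewrite !inE ltnS (ltn_neqAle e) -val_eqE.
  by case: eqP; case: (e \in C).
case: (boolP (i \in C)) => iC.
  rewrite -[RHS](card1 i); apply: eq_card => e; rewrite !inE.
  by case: eqP => [->|]; rewrite ?andbF // iC leqnn.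
apply: eq_card0 => e; rewrite !inE; case: eqP => [->|]; rewrite ?andbF //.
by rewrite (negbTE iC).
Qed.

(* A quotient of powers rather than a truncated difference of exponents: the
   exponent may be negative, but only when another factor of colwt is 0. *)
Definition colfac C D (d : 'I_n) : F :=
  if (d \in D) && (d \notin C) then 1 - t ^+ below C d / t ^+ below D d else 1.

Definition colwt C D : F := \prod_(d < n) colfac C D d.

Definition xprod x C : F := \prod_(i in C) x i.

(** This is the sum B_C, with [l] the sizes of the columns to the right of [C]. The column [C]
    itself contributes no monomial. *)
Fixpoint colsum l C x : F :=
  if l is s :: l' then
    \sum_(D : {set 'I_n} | #|D| == s) colwt C D * xprod x D * colsum l' D x
  else 1.

Section Swap.
Variables i j : 'I_n.
Hypothesis ij : j = i.+1 :> nat.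
Local Notation tau := (tperm i j).

Definition swapset C : {set 'I_n} := tau @^-1: C.

Lemma mem_swapset C d : (d \in swapset C) = (tau d \in C).
Proof. by rewrite inE. Qed.

Lemma swapset_l C : (i \in swapset C) = (j \in C).
Proof. by rewrite inE tpermL. Qed.

Lemma swapset_r C : (j \in swapset C) = (i \in C).
Proof. by rewrite inE tpermR. Qed.

Lemma swapsetK : involutive swapset.
Proof. by move=> C; apply/setP=> d; rewrite !inE tpermK. Qed.

Lemma card_swapset C : #|swapset C| = #|C|.
Proof. by rewrite card_preimset //; apply: perm_inj. Qed.

Lemma neq_ij : i != j.
Proof. by rewrite -val_eqE /= ij neq_ltn ltnSn. Qed.

(** For [d != j] the segment of all e < d contains both or neither of [i] and [j]. *)
Lemma below_swapset C (d : 'I_n) : d != j -> below (swapset C) d = below C d.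
Proof.
move=> dj; rewrite /below -(card_swapset [set e in C | _]); apply: eq_card => e.
rewrite !inE; case: tpermP => [->|->|_ _] //; rewrite ij; congr andb.
  by move: dj; rewrite -val_eqE /= ij (ltn_neqAle i.+1) eq_sym => ->.
by move: dj; rewrite -val_eqE /= ij (ltn_neqAle i.+1) eq_sym => ->.
Qed.

Lemma belowS C : below C j = (below C i + (i \in C))%N.
Proof. by rewrite ij below_succ. Qed.

Definition colrest C D : F := \prod_(d < n | (d != i) && (d != j)) colfac C D d.
Definition colq C D : F := t ^+ below C i / t ^+ below D i.

Lemma colrest_swapl C D : colrest (swapset C) D = colrest C D.
Proof.
apply: eq_bigr => d /andP[di dj]; rewrite /colfac below_swapset //.
by rewrite mem_swapset tpermD // eq_sym.
Qed.

Lemma colrest_swapr C D : colrest C (swapset D) = colrest C D.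
Proof.
apply: eq_bigr => d /andP[di dj]; rewrite /colfac below_swapset //.
by rewrite mem_swapset tpermD // eq_sym.
Qed.

Lemma colq_swapl C D : colq (swapset C) D = colq C D.
Proof. by rewrite /colq below_swapset ?neq_ij. Qed.

Lemma colq_swapr C D : colq C (swapset D) = colq C D.
Proof. by rewrite /colq below_swapset ?neq_ij. Qed.

(** Isolates the two factors that an exchange can alter. As [colq] and [colrest] are invariant under
    exchanges in either column, the Hecke relation reduces to rational identities in [colq], [t],
    [x i] and [x j]. *)
Lemma colwtE C D : colwt C D =
  (if (i \in D) && (i \notin C) then 1 - colq C D else 1) *
  (if (j \in D) && (j \notin C)
   then 1 - colq C D * t ^+ (i \in C) / t ^+ (i \in D) else 1) * colrest C D.
Proof.
rewrite /colwt (bigD1 i) //= (bigD1 j) 1?eq_sym ?neq_ij //= mulrA.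
congr (_ * _ * _); rewrite /colfac; case: ifP => // _; rewrite !belowS /colq !exprD.
by congr (1 - _); rewrite invfM; ring.
Qed.

Lemma xprod_tperm x D : xprod (fun a => x (tau a)) D = xprod x (swapset D).
Proof.
rewrite /xprod (reindex_inj (@perm_inj _ tau)) /=; apply: eq_big => a.
  by rewrite mem_swapset.
by rewrite tpermK.
Qed.

Lemma xprod_swap x D : i \notin D -> j \in D ->
  exists R, xprod x D = x j * R /\ xprod x (swapset D) = x i * R.
Proof.
move=> iD jD; exists (\prod_(a in D | a != j) x a).
rewrite /xprod (bigD1 j) //=; split=> //; rewrite (bigD1 i) ?swapset_l //=.
congr (_ * _); apply: eq_bigl => a; rewrite mem_swapset.
case: tpermP => [->|->|/eqP/negbTE ai /eqP/negbTE aj].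
- by rewrite eqxx andbF (negbTE iD).
- by rewrite eqxx andbF (negbTE iD).
- by rewrite ai aj.
Qed.

Lemma swapset_id D : (i \in D) = (j \in D) -> swapset D = D.
Proof.
move=> e; by apply/setP=> a; rewrite mem_swapset; case: tpermP => [->|->|//].
Qed.

Lemma sum_swap s (G : {set 'I_n} -> F) :
  \sum_(D : {set 'I_n} | #|D| == s) G D =
  \sum_(D : {set 'I_n} | (#|D| == s) && ((i \in D) == (j \in D))) G D +
  \sum_(D : {set 'I_n} | (#|D| == s) && ((i \notin D) && (j \in D)))
     (G D + G (swapset D)).
Proof.
rewrite (bigID (fun D : {set 'I_n} => (i \in D) == (j \in D))) /=; congr (_ + _).
rewrite (bigID (fun D : {set 'I_n} => (j \in D))) /= big_split /=; congr (_ + _).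
  by apply: eq_bigl => D; case: (i \in D); case: (j \in D); rewrite ?andbF ?andbT.
rewrite (reindex_inj (inv_inj swapsetK)) /=; apply: eq_bigl => D.
rewrite card_swapset swapset_l swapset_r.
by case: (i \in D); case: (j \in D); rewrite ?andbF ?andbT.
Qed.

(** The Demazure-Lusztig relation, both halves by one induction on [l]. The next column [D] is
    either fixed by the exchange or paired with [swapset D] by [sum_swap]; on each such orbit the
    claim is a field identity. *)
Lemma colsum_swap l x C : x i != x j ->
  ((i \in C) = (j \in C) -> colsum l C (fun a => x (tau a)) = colsum l C x) /\
  (i \notin C -> j \in C ->
   (x i - x j) * colsum l (swapset C) x =
   (x i - t * x j) * colsum l C (fun a => x (tau a)) - (1 - t) * x j * colsum l C x).
Proof.
elim: l x C => [|s l IH] x C xij.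
  by split=> // *; rewrite /= !mulr1; ring.
(* The induction hypothesis is used at [x] and at the exchanged point [y], so that both values of
   [colsum l (swapset D)] are expressed by those of [colsum l D]. *)
pose y (a : 'I_n) := x (tau a).
have yij : y i != y j by rewrite /y tpermL tpermR eq_sym.
have yK : (fun a => y (tau a)) = x.
  by apply: functional_extensionality => a; rewrite /y tpermK.
have same D : (i \in D) = (j \in D) ->
  (swapset D = D) * (xprod y D = xprod x D) * (colsum l D y = colsum l D x).
  move=> e; have sD := swapset_id e; split; last by case: (IH x D xij) => /(_ e).
  by split=> //; rewrite /y xprod_tperm sD.
have h1 : x i - x j != 0 by rewrite subr_eq0.
have h2 : x j - x i != 0 by rewrite subr_eq0 eq_sym.
have diff D : i \notin D -> j \in D -> exists R,
    xprod x D = x j * R /\ xprod x (swapset D) = x i * R /\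
    xprod y D = x i * R /\ xprod y (swapset D) = x j * R /\
    colsum l (swapset D) x =
      ((x i - t * x j) * colsum l D y - (1 - t) * x j * colsum l D x) / (x i - x j) /\
    colsum l (swapset D) y =
      ((x j - t * x i) * colsum l D x - (1 - t) * x i * colsum l D y) / (x j - x i).
  move=> iD jD; have [R [e1 e2]] := xprod_swap x iD jD; exists R.
  rewrite {1 2}/y !xprod_tperm swapsetK e1 e2; do !split=> //.
  - by case: (IH x D xij) => _ /(_ iD jD) <-; rewrite mulrC mulKf.
  - case: (IH y D yij) => _ /(_ iD jD); rewrite yK /y tpermL tpermR => <-.
    by rewrite mulrC mulKf.
split=> [cij|iC jC] /=; rewrite -/y.
  rewrite !sum_swap; congr (_ + _); apply: eq_bigr => D /andP[_].
    by move/eqP=> /same e; rewrite !e.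
  case/andP=> iD jD; have [R [e1 [e2 [e3 [e4 [e5 e6]]]]]] := diff D iD jD.
  rewrite e1 e2 ?e3 ?e4 e5 ?e6 !colwtE.
  rewrite swapset_l swapset_r colrest_swapr colq_swapr (negbTE iD) jD -cij.
  by case: (i \in C) => /=; field; rewrite ?h1 ?h2 ?oner_neq0.
rewrite !mulr_sumr -sumrB !sum_swap; congr (_ + _); apply: eq_bigr => D /andP[_].
  move/eqP=> e0; have e := same D e0; rewrite !e !colwtE.
  rewrite swapset_l swapset_r colrest_swapl colq_swapl -e0 (negbTE iC) jC.
  by case: (i \in D) => /=; field; rewrite ?t_neq0 ?h1.
case/andP=> iD jD; have [R [e1 [e2 [e3 [e4 [e5 e6]]]]]] := diff D iD jD.
rewrite e1 e2 ?e3 ?e4 e5 ?e6 !colwtE.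
rewrite !swapset_l !swapset_r !colrest_swapl !colrest_swapr !colq_swapl !colq_swapr.
by rewrite (negbTE iC) (negbTE iD) jC jD /=; field; rewrite ?t_neq0 ?h1 ?h2 ?oner_neq0.
Qed.
End Swap.
End Columns.

(** In an increasing sequence the entries below [m] form a prefix. *)
Lemma nth_lt_count (s : seq nat) r m : sorted ltn s -> (r < size s)%N ->
  (nth 0%N s r < m)%N = (r < count (fun e => e < m)%N s)%N.
Proof.
elim: s r => //= a s IH r pa; have sa := path_sorted pa.
case: (ltnP a m) => am.
  by case: r => [|r] //= rs; rewrite IH.
have -> : count (fun e => e < m)%N s = 0%N.
  apply/eqP; rewrite -leqn0 leqNgt -has_count; apply/hasPn=> e es.
  have /allP/(_ e es) /= ae := order_path_min ltn_trans pa; rewrite -leqNgt; lia.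
move=> rs; rewrite ltn0; apply/negbTE; rewrite -leqNgt; case: r rs => [//|r] /= rs.
have /allP/(_ _ (mem_nth 0%N rs)) /= := order_path_min ltn_trans pa; lia.
Qed.

(** * Neighbouring columns: semistandardness and leg factors *)

Section ColumnPair.
Variable n : nat.
Implicit Types C D : {set 'I_n}.

Lemma mem_colseq C (d : 'I_n) : (val d \in colseq C) = (d \in C).
Proof. by rewrite mem_map ?mem_enum //; apply: val_inj. Qed.

Lemma size_colseq C : size (colseq C) = #|C|.
Proof. by rewrite size_map cardE. Qed.

Lemma colseq_sorted C : sorted ltn (colseq C).
Proof.
rewrite /colseq {1}/enum_mem -enumT sorted_map.
apply: sorted_filter; first by move=> a b c; apply: ltn_trans.
by rewrite -sorted_map val_enum_ord iota_ltn_sorted.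
Qed.

Lemma colseq_lt C r : (r < #|C|)%N -> (nth 0%N (colseq C) r < n)%N.
Proof.
by rewrite -size_colseq => /(mem_nth 0%N)/mapP[d _ ->]; apply: ltn_ord.
Qed.

Lemma below_count C m : below C m = count (fun e => e < m)%N (colseq C).
Proof.
rewrite count_map -size_filter /below cardE; congr size.
by rewrite [in RHS]/enum_mem -filter_predI /enum_mem; apply: eq_filter => e; rewrite !inE andbC.
Qed.

Lemma colseq_below C r m : (r < #|C|)%N ->
  (nth 0%N (colseq C) r < m)%N = (r < below C m)%N.
Proof. by move=> rC; rewrite below_count nth_lt_count ?colseq_sorted ?size_colseq. Qed.

Lemma below_nth C r : (r < #|C|)%N -> below C (nth 0%N (colseq C) r) = r.
Proof.
move=> rC; apply/eqP; rewrite eqn_leq leqNgt -colseq_below // ltnn /=.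
case: r rC => // r rC; rewrite -colseq_below ?(ltnW rC) //.
by apply: (sorted_ltn_nth ltn_trans) => //; rewrite ?colseq_sorted ?inE ?size_colseq ?(ltnW rC).
Qed.

Lemma below_full C : below C n = #|C|.
Proof. by apply: eq_card => e; rewrite inE ltn_ord andbT. Qed.

Lemma below_le_card C m : (below C m <= #|C|)%N.
Proof. by apply: subset_leq_card; apply/subsetP=> e; rewrite inE => /andP[]. Qed.

(** The condition that [is_SSYT] imposes on two neighbouring columns. *)
Definition col_le C D : bool :=
  (#|D| <= #|C|)%N &&
  all (fun i => nth 0%N (colseq C) i <= nth 0%N (colseq D) i)%N (iota 0 #|D|).

(** Row [r] of a column has entry below [m] iff [r] is less than its [below] count. In this form
    [col_le] is visibly an order; [m = n] compares the heights. *)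
Lemma col_leP C D :
  reflect (forall m, (m <= n)%N -> (below D m <= below C m)%N) (col_le C D).
Proof.
apply: (iffP andP) => [[DC /allP le] m mn|le].
  case e: (below D m) => [//|r]; have rD : (r < #|D|)%N by rewrite -e below_le_card.
  rewrite -colseq_below ?(leq_trans rD) //; apply: leq_ltn_trans (le r _) _.
    by rewrite mem_iota.
  by rewrite colseq_below // e.
have DC : (#|D| <= #|C|)%N by rewrite -!below_full le.
split=> //; apply/allP=> r; rewrite mem_iota /= add0n => rD.
have rC : (r < #|C|)%N by apply: leq_trans DC.
rewrite -ltnS (colseq_below _ rC); apply: leq_trans (le _ (colseq_lt rD)).
by rewrite -(colseq_below _ rD).
Qed.

Lemma col_le_trans : transitive col_le.
Proof.
move=> C D E /col_leP h1 /col_leP h2; apply/col_leP=> m mn.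
exact: leq_trans (h2 m mn) (h1 m mn).
Qed.

Lemma col_le_anti : antisymmetric col_le.
Proof.
move=> C D /andP[/col_leP h1 /col_leP h2].
have e m : (m <= n)%N -> below C m = below D m.
  by move=> mn; apply/eqP; rewrite eqn_leq h1 ?h2.
apply/setP=> i; have := e i.+1 (ltn_ord i); rewrite !below_succ e 1?ltnW //.
by case: (i \in C); case: (i \in D) => //; lia.
Qed.

Variables (F : fieldType) (t : F).
Hypothesis t_neq0 : t != 0.

(** Scanning [m] upwards, [below D m] can gain on [below C m] only at an element of [D] outside [C].
    If the two counts agree there, the factor is 1 - 1 = 0, so a nonzero weight excludes a first
    violation. *)
Lemma colwt_col_le C D : colwt t C D != 0 -> col_le C D.
Proof.
move=> /prodf_neq0 nz; apply/col_leP; elim=> [|m IH] mn.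
  by rewrite /below eq_card0 // => e; rewrite !inE andbF.
have {}IH := IH (ltnW mn).
have [o om] : exists o : 'I_n, m = o by exists (Ordinal mn).
have := nz o isT; rewrite {}om in IH *; rewrite /colfac !below_succ.
have [oD|oD] := boolP (o \in D); have [oC|oC] := boolP (o \in C) => //= h.
- by rewrite leq_add2r.
- rewrite addn0 addn1 ltn_neqAle IH andbT; apply: contra h => /eqP e.
  by rewrite e divff ?subrr // expf_neq0.
- by rewrite addn0 addn1 leqW.
- by rewrite !addn0.
Qed.

Lemma colwtxx C : colwt t C C = 1.
Proof. by apply: big1 => d _; rewrite /colfac andbN. Qed.

Lemma colwtT D : colwt t setT D = 1.
Proof. by apply: big1 => d _; rewrite /colfac in_setT andbF. Qed.

Definition legset C D (i : nat) : {set 'I_n} :=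
  if (i < #|C|)%N && (i < #|D|)%N && (nth 0%N (colseq D) i \notin colseq C)
  then [set k in C | (nth 0%N (colseq C) i <= val k <= nth 0%N (colseq D) i)%N]
  else set0.

(** The leg consists of the entries of [C] from its [i]-th entry up to that of [D], which is not in
    [C]; exactly [i] entries of [C] precede the leg. *)
Lemma card_legset C D i : col_le C D -> (i < #|D|)%N ->
  nth 0%N (colseq D) i \notin colseq C ->
  (#|legset C D i| + i = below C (nth 0%N (colseq D) i))%N /\ (0 < #|legset C D i|)%N.
Proof.
move=> /andP[DC /allP le] iD niC; have iC : (i < #|C|)%N by apply: leq_trans DC.
have {}le := le i; rewrite mem_iota /= add0n iD in le; have {}le := le isT.
rewrite /legset iC iD niC /=.
set c := nth 0%N (colseq C) i in le *; set d := nth 0%N (colseq D) i in le niC *.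
have cC : c \in colseq C by apply: mem_nth; rewrite size_colseq.
have cd : (c < d)%N by rewrite ltn_neqAle le andbT; apply: contra niC => /eqP <-.
split; last first.
  case/mapP: cC => k; rewrite mem_enum => kC ck; apply/card_gt0P; exists k.
  by rewrite inE kC -ck leqnn ltnW.
rewrite -[X in (_ + X)%N](below_nth iC) -/c /below.
rewrite -[RHS](cardID [pred k : 'I_n | (c <= k)%N]); congr (_ + _)%N; apply: eq_card => k.
  rewrite !inE andbAC; case: (boolP (k \in C)) => //= kC.
  case: (c <= k)%N; rewrite ?andbF //= ?andbT leq_eqVlt; case: eqP => //= e.
  by case/negP: niC; rewrite -e mem_colseq.
by rewrite !inE -ltnNge; case: (k \in C) => //=; lia.
Qed.

(** Rows are reindexed by the entries d of [D]. Since [below D d] is the row of d, [card_legset]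
    identifies the leg length with the exponent in [colfac]. *)
Lemma prod_legset C D : col_le C D ->
  \prod_(i < n | legset C D i != set0) (1 - t ^+ #|legset C D i|) = colwt t C D.
Proof.
move=> CD; have Dn : (#|D| <= n)%N by rewrite -[X in (_ <= X)%N](card_ord n) max_card.
pose f v := if v \notin colseq C then 1 - t ^+ below C v / t ^+ below D v else 1.
transitivity (\prod_(v <- colseq D) f v); last first.
  rewrite /colseq big_map big_enum /= [LHS]big_mkcond; apply: eq_bigr => i _.
  by rewrite /colfac /f mem_colseq; case: (i \in D); case: (i \in C).
rewrite (big_nth 0%N) size_colseq big_mkord.
rewrite (big_ord_widen n (fun i => f (nth 0%N (colseq D) i)) Dn).
rewrite big_mkcond [RHS]big_mkcond; apply: eq_bigr => i _; rewrite /f.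
case: (ltnP i #|D|) => iD; last by rewrite /legset [(i < #|D|)%N]ltnNge iD andbF eqxx.
case: (boolP (_ \in colseq C)) => /= niC; first by rewrite /legset niC andbF eqxx.
have [e l0] := card_legset CD iD niC.
by rewrite -card_gt0 l0 -e below_nth // exprD mulfK // expf_neq0.
Qed.

End ColumnPair.

(** * Hall-Littlewood symmetrization *)

Section LastSet.
Variable n : nat.
Implicit Types D : {set 'I_n}.

Definition lastset (r : nat) : {set 'I_n} := [set i : 'I_n | (n - r <= i)%N].

(** Total distance from the right end; it counts the powers of [t] produced by moving [D] there. *)
Definition wt D : nat := \sum_(d in D) rev_ord d.

Lemma card_lastset r : (r <= n)%N -> #|lastset r| = r.
Proof.
move=> rn; rewrite -sum1_card (reindex_inj rev_ord_inj) /=.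
rewrite -[RHS]card_ord -sum1_card (big_ord_widen n (fun=> 1%N) rn).
by apply: eq_bigl => i; rewrite inE /=; have := ltn_ord i; lia.
Qed.

Lemma lastset_full : lastset n = setT.
Proof. by apply/setP=> i; rewrite !inE subnn. Qed.

Lemma lastsetS r s : (r <= s)%N -> lastset r \subset lastset s.
Proof. by move=> rs; apply/subsetP=> i; rewrite !inE; lia. Qed.

Lemma lastset_of_upclosed D :
  (forall i j : 'I_n, j = i.+1 :> nat -> i \in D -> j \in D) -> D = lastset #|D|.
Proof.
move=> up.
have up' m (i k : 'I_n) : k = (i + m)%N :> nat -> i \in D -> k \in D.
  elim: m i => [|m IH] i e iD; first by rewrite (_ : k = i) //; apply: val_inj; rewrite /= e addn0.
  have i1n : (i.+1 < n)%N by have := ltn_ord k; lia.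
  by apply: (IH (Ordinal i1n)); [rewrite /=; lia | apply: up iD].
have {}up' (i k : 'I_n) : (i <= k)%N -> i \in D -> k \in D.
  by move=> ik; apply: (up' (k - i)%N); lia.
have Dn : (#|D| <= n)%N by rewrite -[X in (_ <= X)%N](card_ord n) max_card.
apply/setP=> i; rewrite inE; apply/idP/idP => [iD|].
  have := subset_leq_card (_ : lastset (n - i) \subset D).
  rewrite card_lastset; last by lia.
  have lin := ltn_ord i.
  move=> h; suff: (n - i <= #|D|)%N by lia.
  by apply: h; apply/subsetP=> k; rewrite inE => le; apply: up' iD; lia.
apply: contraLR => iD; have lin := ltn_ord i.
have := subset_leq_card (_ : D \subset lastset (n - i.+1)).
rewrite card_lastset; last by lia.
move=> h; suff: (#|D| <= n - i.+1)%N by lia.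
apply: h; apply/subsetP=> k kD; rewrite inE; case: (leqP k i) => ki; last by lia.
by rewrite (up' _ _ ki kD) in iD.
Qed.

Lemma wt_swap (i j : 'I_n) D : j = i.+1 :> nat -> i \notin D -> j \in D ->
  wt (swapset i j D) = (wt D).+1.
Proof.
move=> ij iD jD; rewrite /wt [in RHS](bigD1 j) //= [in LHS](bigD1 i) ?swapset_l //=.
rewrite -addSn; congr (_ + _)%N; first by have := ltn_ord j; lia.
apply: eq_bigl => a; rewrite mem_swapset.
case: tpermP => [->|->|/eqP/negbTE ai /eqP/negbTE aj].
- by rewrite eqxx andbF (negbTE iD).
- by rewrite eqxx andbF (negbTE iD).
- by rewrite ai aj.
Qed.

End LastSet.

Section Symmetrizer.
Variables (F : fieldType) (n : nat) (t : F) (x : 'I_n -> F).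
Hypotheses (t_neq0 : t != 0) (x_inj : injective x).
Implicit Types (C D : {set 'I_n}) (y : 'I_n -> F) (g u : ('I_n -> F) -> F).

Definition hlratio y (i j : 'I_n) : F := (y i - t * y j) / (y i - y j).

(** The order of positions is opposite to that in [HL_P], to match columns pushed to the end;
    [HL_colsum] reverses it. *)
Definition kernel y : F := \prod_(p : 'I_n * 'I_n | (p.2 < p.1)%N) hlratio y p.1 p.2.

Definition symm g : F :=
  \sum_(w : 'S_n) kernel (fun a => x (w a)) * g (fun a => x (w a)).

Lemma eq_symm g1 g2 : (forall y, g1 y = g2 y) -> symm g1 = symm g2.
Proof. by move=> e; apply: eq_bigr => w _; rewrite e. Qed.

Lemma symm_sum (I : finType) (P : pred I) (g : I -> ('I_n -> F) -> F) :
  symm (fun y => \sum_(i | P i) g i y) = \sum_(i | P i) symm (g i).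
Proof. by rewrite /symm exchange_big /=; apply: eq_bigr => w _; rewrite mulr_sumr. Qed.

Section SymmSwap.
Variables i j : 'I_n.
Hypothesis ij : j = i.+1 :> nat.
Local Notation tau := (tperm i j).

Definition kernel_rest y : F :=
  \prod_(p : 'I_n * 'I_n | (p.2 < p.1)%N && (p != (j, i))) hlratio y p.1 p.2.

Lemma kernelE y : kernel y = hlratio y j i * kernel_rest y.
Proof. by rewrite /kernel (bigD1 (j, i)) //= ij ltnSn. Qed.

(** An adjacent transposition inverts only the pair of [i] and [j] and permutes the other ordered
    pairs. *)
Lemma kernel_rest_swap y : kernel_rest (fun a => y (tau a)) = kernel_rest y.
Proof.
rewrite /kernel_rest (reindex_inj (h := fun p : 'I_n * 'I_n => (tau p.1, tau p.2))) /=; last first.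
  by move=> [a b] [c d] /= [e1 e2]; rewrite (perm_inj e1) (perm_inj e2).
apply: eq_big => [[a b]|[a b] _]; last by rewrite /hlratio /= !tpermK.
rewrite /= !xpair_eqE -!val_eqE /=.
by case: tpermP => [->|->|/eqP + /eqP +]; case: tpermP => [->|->|/eqP + /eqP +];
  rewrite -?val_eqE /= ij; lia.
Qed.

(** The Demazure-Lusztig relation splits the left side in two sums, one with [h] at the exchanged
    point and one with [h] at the point itself. *)
Lemma symm_swap l u D : i \notin D -> j \in D ->
  (forall y, u (fun a => y (tau a)) = u y) ->
  symm (fun y => u y * xprod y (swapset i j D) * colsum t l (swapset i j D) y) =
  t * symm (fun y => u y * xprod y D * colsum t l D y).
Proof.
move=> iD jD uinv; rewrite /symm mulr_sumr.
have nij (w : 'S_n) : x (w i) - x (w j) != 0.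
  by rewrite subr_eq0; apply/eqP=> /x_inj /perm_inj e; move: (neq_ij ij); rewrite e eqxx.
have nji (w : 'S_n) : x (w j) - x (w i) != 0 by rewrite -opprB oppr_eq0.
pose h (y : 'I_n -> F) := xprod y D * colsum t l D y.
transitivity (\sum_(w : 'S_n) (kernel (fun a => x (w a)) * u (fun a => x (w a)) *
    hlratio (fun a => x (w a)) i j * h (fun a => x (w (tau a)))) +
  \sum_(w : 'S_n) - (kernel (fun a => x (w a)) * u (fun a => x (w a)) *
    ((1 - t) * x (w i) / (x (w i) - x (w j))) * h (fun a => x (w a)))).
  rewrite -big_split /=; apply: eq_bigr => w _; set y := fun a => x (w a).
  have yij : y i != y j by rewrite -subr_eq0 nij.
  have [_ /(_ iD jD)] := colsum_swap t_neq0 ij l D yij.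
  have [R [e1 e2]] := xprod_swap y iD jD.
  move=> e; have nyij : y i - y j != 0 by rewrite nij.
  apply: (mulfI nyij); transitivity (kernel y * u y * xprod y (swapset i j D) *
    ((y i - y j) * colsum t l (swapset i j D) y)); first by ring.
  rewrite e.
  rewrite /h -[fun a => x (w (tau a))]/(fun a => y (tau a)) (xprod_tperm i j y) e2 e1 /hlratio -/y.
  rewrite -[x (w i)]/(y i) -[x (w j)]/(y j).
  by field; rewrite ?nyij.
(* Replacing [w] by [tau * w] in the first sum exchanges y_i and y_j. The coefficients then add up
   to (y_i - t y_j)/(y_i - y_j) - (1 - t) y_i/(y_i - y_j) = t. *)
rewrite (reindex_inj (mulgI tau)) /= -big_split /=; apply: eq_bigr => w _.
have -> : (fun a => x ((tau * w)%g (tau a))) = fun a => x (w a).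
  by apply: functional_extensionality => a; rewrite permM tpermK.
have -> : (fun a => x ((tau * w)%g a)) = fun a => x (w (tau a)).
  by apply: functional_extensionality => a; rewrite permM.
pose y a := x (w a); rewrite -[fun a => x (w (tau a))]/(fun a => y (tau a)).
rewrite -[fun a => x (w a)]/y uinv !kernelE kernel_rest_swap /hlratio.
rewrite tpermL tpermR /h -[x (w i)]/(y i) -[x (w j)]/(y j).
by field; rewrite ?nij ?nji.
Qed.

End SymmSwap.

Definition lastinv r u := forall (i j : 'I_n) y,
  j = i.+1 :> nat -> i \in lastset n r -> u (fun a => y (tperm i j a)) = u y.

(** Induction on [wt D]: unless [D] is a final segment, some [i] in [D] has its successor outside,
    and exchanging them lowers [wt] by one while [symm_swap] supplies one factor [t]. *)
Lemma symm_sort l u r D : lastinv r u -> D \subset lastset n r ->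
  t ^+ wt (lastset n #|D|) * symm (fun y => u y * xprod y D * colsum t l D y) =
  t ^+ wt D *
  symm (fun y => u y * xprod y (lastset n #|D|) * colsum t l (lastset n #|D|) y).
Proof.
move=> uinv; have [m] := ubnP (wt D); elim: m D => // m IH D.
rewrite ltnS => wtD Dr; case: (boolP [forall i : 'I_n, forall j : 'I_n,
    (j == i.+1 :> nat) && (i \in D) ==> (j \in D)]) => [up|].
  have <- : D = lastset n #|D| => //.
  apply: lastset_of_upclosed => i j ij iD.
  by move: up => /forallP/(_ i)/forallP/(_ j); rewrite iD -ij eqxx.
case/forallPn=> i /forallPn[j]; rewrite negb_imply => /andP[/andP[/eqP ij iD] jD].
have := wt_swap (D := swapset i j D) ij; rewrite swapset_l swapset_r swapsetK.
move=> /(_ jD iD) e; rewrite e in wtD *.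
have ir : i \in lastset n r by apply: (subsetP Dr).
have sDr : swapset i j D \subset lastset n r.
  apply/subsetP=> a; rewrite mem_swapset; case: tpermP => [->|->|_ _] //.
    by move: ir; rewrite !inE ij; lia.
  exact: (subsetP Dr).
have := IH _ wtD sDr; rewrite card_swapset => IH'.
have := @symm_swap i j ij l u (swapset i j D).
rewrite swapset_l swapset_r swapsetK => /(_ jD iD) ->; last first.
  by move=> y; apply: uinv.
by rewrite mulrCA IH' mulrA exprS.
Qed.

End Symmetrizer.

(** * Quantum factorials and Gaussian binomial sums *)

Section Quantum.
Variables (F : fieldType) (n : nat) (t : F).
Hypotheses (t_neq0 : t != 0) (qn_neq0 : forall i, 1 - t ^+ i.+1 != 0).

Definition qint (i : nat) : F := (1 - t ^+ i) / (1 - t).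
Definition qfact (m : nat) : F := \prod_(i < m) qint i.+1.

Lemma subr1t_neq0 : 1 - t != 0.
Proof. by rewrite -[t]expr1. Qed.

Lemma qint_neq0 i : qint i.+1 != 0.
Proof. by rewrite mulf_neq0 ?invr_neq0 ?subr1t_neq0. Qed.

Lemma qfactS m : qfact m.+1 = qfact m * qint m.+1.
Proof. by rewrite /qfact big_ord_recr. Qed.

Lemma qfact0 : qfact 0 = 1.
Proof. by rewrite /qfact big_ord0. Qed.

Lemma qfact_neq0 m : qfact m != 0.
Proof. by apply/prodf_neq0 => i _; apply: qint_neq0. Qed.

Lemma qintD a b : qint (a + b) = qint a + t ^+ a * qint b.
Proof. by rewrite /qint exprD; field; rewrite subr1t_neq0. Qed.

Lemma lastset_succ r : (r < n)%N -> exists p : 'I_n,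
  [/\ rev_ord p = r :> nat, p \notin lastset n r & lastset n r.+1 = p |: lastset n r].
Proof.
move=> rn; exists (rev_ord (Ordinal rn)); split.
- by rewrite /=; lia.
- by rewrite inE /=; lia.
by apply/setP=> i; rewrite !inE -val_eqE /=; have := ltn_ord i; lia.
Qed.

Lemma wt_setU1 (p : 'I_n) (D : {set 'I_n}) :
  p \notin D -> wt (p |: D) = (rev_ord p + wt D)%N.
Proof. by move=> pD; rewrite /wt big_setU1. Qed.

(** Up to a power of [t], a Gaussian binomial coefficient: see [qsumE]. *)
Definition qsum (r s : nat) : F :=
  \sum_(D : {set 'I_n} | (D \subset lastset n r) && (#|D| == s)) t ^+ wt D.

Lemma sum_subset_setU1 (I : finType) (A : {set I}) (p : I) (G : {set I} -> F) :
  p \notin A ->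
  \sum_(D : {set I} | D \subset p |: A) G D =
  \sum_(D : {set I} | D \subset A) (G D + G (p |: D)).
Proof.
move=> pA; rewrite (bigID (fun D : {set I} => p \in D)) /= addrC big_split /=.
congr (_ + _).
  apply: eq_bigl => D; apply/andP/idP => [[DA pD]|DA].
    apply/subsetP=> a aD; have := subsetP DA a aD; rewrite !inE.
    by case: eqP => [e|//]; rewrite -e aD in pD.
  split; last by apply: contra pA; apply: (subsetP DA).
  by apply: subset_trans DA _; apply: subsetUr.
rewrite (reindex_onto (fun D : {set I} => p |: D) (fun D => D :\ p)) /=; last first.
  by move=> D /andP[_ pD]; apply: setD1K.
apply: eq_bigl => D; rewrite setU11 andbT.
apply/andP/idP => [[DA /eqP e]|DA].
  apply/subsetP=> a; rewrite -e !inE => /andP[ap aD].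
  have := subsetP DA a; rewrite !inE (negbTE ap) /= in aD *.
  by rewrite aD; apply.
have pD : p \notin D by apply: contra pA; apply: (subsetP DA).
by split; [apply: setUS | rewrite setU1K].
Qed.

(** The q-Pascal rule: subsets are split by whether they contain the new position, which has
    distance [r] from the end. *)
Lemma qsumS r s : (r < n)%N ->
  qsum r.+1 s.+1 = qsum r s.+1 + t ^+ r * qsum r s.
Proof.
move=> rn; have [p [pr pr' e]] := lastset_succ rn.
rewrite /qsum e big_mkcondr /= sum_subset_setU1 // mulr_sumr big_split /=.
rewrite -!big_mkcondr /=; congr (_ + _); rewrite [LHS]big_mkcondr [RHS]big_mkcondr /=.
apply: eq_bigr => D DA.
have pD : p \notin D by apply: contra pr'; apply: (subsetP DA).
by rewrite cardsU1 pD add1n eqSS wt_setU1 // pr exprD.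
Qed.

Lemma qsum0 r : qsum r 0 = 1.
Proof.
rewrite /qsum (big_pred1 set0) => [|D].
  by rewrite /wt big_set0 expr0.
by rewrite /= cards_eq0; case: eqP => [->|_]; rewrite ?andbF ?sub0set.
Qed.

Lemma wt_lastset0 : wt (lastset n 0) = 0%N.
Proof. by rewrite /wt big1 // => i; rewrite inE subn0 leqNgt ltn_ord. Qed.

Lemma qsumE r s : (r <= n)%N -> (s <= r)%N ->
  qsum r s * qfact s * qfact (r - s) = t ^+ wt (lastset n s) * qfact r.
Proof.
elim: r s => [|r IH] [|s] rn sr //.
- by rewrite qsum0 wt_lastset0 qfact0 !mulr1.
- by rewrite qsum0 wt_lastset0 qfact0 subn0 !mulr1.
rewrite qsumS // subSS.
have sn : (s < n)%N by lia.
have wtS : t ^+ wt (lastset n s.+1) = t ^+ s * t ^+ wt (lastset n s).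
  by have [p [ps ps' ->]] := lastset_succ sn; rewrite wt_setU1 // ps exprD.
have IHs := IH s (ltnW rn) sr.
(* For [s = r] the first term of the Pascal rule is an empty sum, outside the range of the induction
   hypothesis. *)
have [{}sr|e] : (s < r)%N \/ s = r by lia.
  have := IH s.+1 (ltnW rn) sr.
  have -> : (r - s = (r - s.+1).+1)%N by lia.
  move=> IHs1.
  have e : (r.+1 = (r - s.+1).+1 + s.+1)%N by lia.
  transitivity ((qsum r s.+1 * qfact s.+1 * qfact (r - s.+1)) * qint (r - s.+1).+1 +
    t ^+ r * (qsum r s * qfact s * qfact (r - s)) * qint s.+1).
    rewrite !(qfactS s) (_ : (r - s = (r - s.+1).+1)%N) ?qfactS; last by lia.
    by ring.
  rewrite IHs1 IHs wtS (qfactS r) [in qint r.+1]e qintD.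
  rewrite [in t ^+ r](_ : r = (s + (r - s.+1).+1)%N) ?exprD; last by lia.
  by ring.
have -> : qsum r s.+1 = 0.
  apply: big_pred0 => D; apply/andP=> -[DA /eqP cD].
  by have := subset_leq_card DA; rewrite card_lastset ?(ltnW rn) // cD e ltnn.
transitivity (t ^+ r * (qsum r s * qfact s * qfact (r - s)) * qint s.+1).
  by rewrite (qfactS s); ring.
by rewrite IHs wtS e qfactS; ring.
Qed.

End Quantum.

(** * Lagrange interpolation and the value of the symmetrizer at 1 *)

Lemma size_prod_XsubC_set (F : fieldType) (I : finType) (A : {set I}) (a : I -> F) :
  size (\prod_(i in A) ('X - (a i)%:P)) = #|A|.+1.
Proof. by rewrite -big_enum /= size_prod_XsubC -cardE. Qed.

(* Lagrange interpolation of prod_i (z - t y_i) - prod_i (z - y_i) at the nodes y_i,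
   evaluated at z = 0. *)
Lemma lagrange_qint (F : fieldType) (t : F) (I : finType) (A : {set I}) (y : I -> F) :
  1 - t != 0 -> {in A &, injective y} -> {in A, forall i, y i != 0} ->
  \sum_(p in A) \prod_(j in A | j != p) ((y p - t * y j) / (y p - y j)) =
  qint t #|A|.
Proof.
move=> t1 yinj y0.
(* The value of [P] at the node [y p] divided by that of [N p]; [Q] vanishes there. *)
pose c p := (1 - t) * y p * \prod_(j in A | j != p) ((y p - t * y j) / (y p - y j)).
pose N (p : I) : {poly F} := \prod_(j in A | j != p) ('X - (y j)%:P).
pose P := \prod_(i in A) ('X - (t * y i)%:P).
pose Q := \prod_(i in A) ('X - (y i)%:P).
have Pm : P \is monic by apply: monic_prod_XsubC.
have Qm : Q \is monic by apply: monic_prod_XsubC.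
have sP : size P = #|A|.+1 by apply: size_prod_XsubC_set.
have sQ : size Q = #|A|.+1 by apply: size_prod_XsubC_set.
pose Z := P - Q - \sum_(p in A) c p *: N p.
have sN p : p \in A -> size (N p) = #|A|.
  move=> pA; rewrite /N (eq_bigl (fun j => j \in A :\ p)) => [|j]; last first.
    by rewrite !inE andbC.
  by rewrite size_prod_XsubC_set (cardsD1 p A) pA.
(* [P] and [Q] are monic of the same degree, so their leading terms cancel. [Z] then has more roots
   than its degree allows. *)
have sZ : (size Z <= #|A|)%N.
  apply/leq_sizeP => k; rewrite leq_eqVlt /Z !coefB => /orP[/eqP <-|lk].
    have := monicP Pm; have := monicP Qm; rewrite /lead_coef sP sQ /= => -> ->.
    rewrite subrr sub0r coef_sum big1 ?oppr0 // => p pA.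
    by rewrite coefZ nth_default ?mulr0 // sN.
  rewrite !nth_default ?sP ?sQ // ?subrr ?sub0r ?oppr0; last first.
    apply: (leq_trans _ (ltnW lk)); apply: (leq_trans (size_sum _ _ _)).
    by apply/bigmax_leqP=> p pA; apply: (leq_trans (size_scale_leq _ _)); rewrite sN.
  done.
have Z0 : Z = 0.
  apply: (roots_geq_poly_eq0 (rs := [seq y i | i <- enum A])).
  - apply/allP=> _ /mapP[q + ->]; rewrite mem_enum => qA.
    rewrite rootE /Z !hornerD !hornerN horner_sum (bigD1 q) //= big1 => [|p /andP[pA pq]].
      rewrite hornerZ !horner_prod (bigD1 q) //= [X in _ - X - _](bigD1 q) //=.
      rewrite !hornerXsubC subrr mul0r subr0 addr0 /c -[X in _ - X]mulrA -big_split /=.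
      rewrite subr_eq0 (_ : y q - t * y q = (1 - t) * y q); last by ring.
      apply/eqP; congr (_ * _); apply: eq_bigr => j /andP[jA jq].
      rewrite !hornerXsubC divfK // subr_eq0; apply: contra jq => /eqP /yinj e.
      by rewrite e.
    rewrite hornerZ horner_prod (bigD1 q) /= ?qA 1?eq_sym // hornerXsubC subrr mul0r.
    by rewrite mulr0.
  - by rewrite map_inj_in_uniq ?enum_uniq // => i j; rewrite !mem_enum; apply: yinj.
  - by rewrite size_map -cardE.
have Y0 : \prod_(i in A) - y i != 0 by apply/prodf_neq0 => i /y0; rewrite oppr_eq0.
have := congr1 (horner^~ 0) Z0; rewrite /Z !hornerD !hornerN horner_sum horner0 !horner_prod.
rewrite (eq_bigr (fun i => t * - y i)) => [|i _]; last by rewrite hornerXsubC; ring.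
rewrite big_split /= prodr_const.
rewrite [X in _ - X - _](eq_bigr (fun i => - y i)) => [|i _]; last first.
  by rewrite hornerXsubC sub0r.
rewrite [\sum_(p in A) _](eq_bigr (fun p => - (1 - t) * \prod_(i in A) - y i *
   \prod_(j in A | j != p) ((y p - t * y j) / (y p - y j)))) => [|p pA]; last first.
  rewrite hornerZ horner_prod [in RHS](bigD1 p) //= /c.
  have -> : \prod_(j in A | j != p) ('X - (y j)%:P).[0] = \prod_(j in A | j != p) - y j.
    by apply: eq_bigr => j _; rewrite hornerXsubC sub0r.
  by ring.
rewrite -mulr_sumr; move: (\sum_(p in A) _) => S e.
apply: (mulfI Y0); apply: (mulfI t1); rewrite /qint.
transitivity ((1 - t ^+ #|A|) * \prod_(i in A) - y i); last by field.
by apply/eqP; rewrite -subr_eq0 -e; apply/eqP; ring.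
Qed.

Section Averaging.
Variables (F : fieldType) (n : nat) (t : F) (x : 'I_n -> F).
Hypotheses (qn_neq0 : forall i, 1 - t ^+ i.+1 != 0) (char0 : forall i, i.+1%:R != 0 :> F).
Hypotheses (x_inj : injective x) (x_neq0 : forall i, x i != 0).
Implicit Types (y : 'I_n -> F) (g : ('I_n -> F) -> F).

Definition kernel_upto (m : nat) y : F :=
  \prod_(p : 'I_n * 'I_n | (p.2 < p.1)%N && (p.1 < m)%N) hlratio t y p.1 p.2.

(* Averaging over the transpositions of m with p <= m turns the factors of the
   kernel gained at step m into the sum of lagrange_qint. *)
Lemma sum_kernel_upto m g : (m <= n)%N ->
  (forall (i j : 'I_n) y, (i < m)%N -> (j < m)%N -> g (fun a => y (tperm i j a)) = g y) ->
  \sum_(w : 'S_n) kernel_upto m (fun a => x (w a)) * g (fun a => x (w a)) =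
  qfact t m / m`!%:R * \sum_(w : 'S_n) g (fun a => x (w a)).
Proof.
elim: m g => [|m IH] g mn ginv.
  rewrite qfact0 fact0 invr1 !mul1r; apply: eq_bigr => w _.
  by rewrite /kernel_upto big_pred0 ?mul1r // => p; rewrite ltn0 andbF.
pose M := Ordinal mn.
pose h y := \prod_(j < n | (j < m)%N) hlratio t y M j.
have kE y : kernel_upto m.+1 y = kernel_upto m y * h y.
  rewrite /kernel_upto (bigID (fun p : 'I_n * 'I_n => (p.1 < m)%N)) /=; congr (_ * _).
    by apply: eq_bigl => p; lia.
  rewrite /h (reindex_onto (fun j => (M, j)) snd) /=.
    by apply: eq_bigl => j; rewrite eqxx; lia.
  by move=> [a b] /= ab; congr pair; apply: val_inj => /=; lia.
(* Being symmetric in the first [m] positions, [h] can be absorbed into [g] for the induction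
   hypothesis. *)
have hinv (i j : 'I_n) y : (i < m)%N -> (j < m)%N -> h (fun a => y (tperm i j a)) = h y.
  move=> im jm; rewrite /h (reindex_inj (@perm_inj _ (tperm i j))) /=.
  apply: eq_big => [a|a _].
    by case: tpermP => [->|->|//]; rewrite ?im ?jm.
  by rewrite /hlratio tpermK tpermD // -val_eqE /=; lia.
have m1 : m.+1%:R != 0 :> F by apply: char0.
have mf : m`!%:R != 0 :> F by case: m`! (fact_gt0 m).
transitivity (\sum_(w : 'S_n) kernel_upto m (fun a => x (w a)) *
   (h (fun a => x (w a)) * g (fun a => x (w a)))).
  by apply: eq_bigr => w _; rewrite kE mulrA.
rewrite (IH (fun y => h y * g y)) ?(ltnW mn) //; last first.
  by move=> i j y im jm; rewrite hinv // ginv // ltnS ltnW.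
suff e : m.+1%:R * \sum_(w : 'S_n) (h (fun a => x (w a)) * g (fun a => x (w a))) =
    qint t m.+1 * \sum_(w : 'S_n) g (fun a => x (w a)).
  apply: (mulfI m1); rewrite mulrCA e qfactS factS natrM.
  move: (m.+1%:R : F) m1 (m`!%:R : F) mf => a a0 b b0.
  by field; rewrite a0 b0.
pose A := [set p : 'I_n | (p < m.+1)%N].
have cA : #|A| = m.+1 by apply: card_ltn_ord.
(* The factor [m.+1] becomes a sum over p <= m; in the copy of index p, [w] is replaced by
   [tperm p M * w], which [g] does not see. *)
rewrite -{1}cA -sumr_const mulr_suml.
transitivity (\sum_(p in A) \sum_(w : 'S_n)
    h (fun a => x (w (tperm p M a))) * g (fun a => x (w a))).
  apply: eq_bigr => p; rewrite inE => pm.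
  rewrite mul1r (reindex_inj (mulgI (tperm p M))) /=; apply: eq_bigr => w _.
  have -> : (fun a => x ((tperm p M * w)%g a)) = fun a => x (w (tperm p M a)).
    by apply: functional_extensionality => a; rewrite permM.
  by rewrite (ginv p M (fun a => x (w a))).
rewrite exchange_big mulr_sumr; apply: eq_bigr => w _ /=.
rewrite -mulr_suml -cA -(@lagrange_qint _ t _ A (fun a => x (w a))).
- congr (_ * _); apply: eq_bigr => p; rewrite inE ltnS => pm.
  rewrite /h (reindex_inj (@perm_inj _ (tperm p M))) /=.
  apply: eq_big => [a|a _]; last by rewrite /hlratio tpermK tpermR.
  rewrite inE; case: tpermP => [->|->|/eqP + /eqP +]; rewrite -?val_eqE /=; lia.
- by rewrite -[t]expr1.
- by move=> i j _ _ /x_inj/perm_inj.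
- by move=> i _.
Qed.

Lemma symm1 : symm t x (fun=> 1) = qfact t n.
Proof.
have := @sum_kernel_upto n (fun=> 1) (leqnn n) (fun _ _ _ _ _ => erefl).
have nf : n`!%:R != 0 :> F by case: n`! (fact_gt0 n).
rewrite sumr_const card_Sn divfK // => <-; apply: eq_bigr => w _; congr (_ * _).
by apply: eq_bigl => p; rewrite ltn_ord andbT.
Qed.

End Averaging.

(** Induction on the distance: with k = j - 1, [tperm i j] is the conjugate of [tperm k j] by
    [tperm i k]. *)
Lemma adjacent_tperm_ind (n : nat) (P : 'S_n -> Prop) :
  P 1%g -> (forall s w, P s -> P w -> P (s * w)%g) ->
  (forall i j : 'I_n, j = i.+1 :> nat -> P (tperm i j)) -> forall w, P w.
Proof.
move=> P1 PM Padj.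
have Pt m (i j : 'I_n) : j = (i + m)%N :> nat -> P (tperm i j).
  elim: m i j => [|m IH] i j e.
    by rewrite (_ : j = i) ?tperm1 //; apply: val_inj; rewrite /= e addn0.
  have [m0|m0] := posnP m; first by apply: Padj; lia.
  have kn : (j.-1 < n)%N by have := ltn_ord j; lia.
  pose k := Ordinal kn.
  have Pik : P (tperm i k) by apply: IH; rewrite /= e; lia.
  have Pkj : P (tperm k j) by apply: Padj; rewrite /= e; lia.
  have -> : tperm i j = ((tperm k j) ^ (tperm i k))%g.
    by rewrite tpermJ tpermR tpermD // -val_eqE /=; lia.
  by rewrite /conjg tpermV; apply: (PM) => //; apply: (PM).
move=> w; have [ts -> _] := prod_tpermP w.
elim/big_rec: _ => // -[i j] s _ Ps /=; apply: PM => //.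
case: (leqP i j) => ij; first by apply: (Pt (j - i)%N); lia.
by rewrite tpermC; apply: (Pt (i - j)%N); lia.
Qed.

Lemma prod_iota0 (R : pzSemiRingType) k (G : nat -> R) :
  \prod_(j <- iota 0 k) G j = \prod_(j < k) G j.
Proof. by rewrite -(big_mkord predT) /index_iota subn0. Qed.

(** * The Hall-Littlewood polynomial as a column sum *)

Section Iterate.
Variables (F : fieldType) (n : nat) (t : F) (x : 'I_n -> F).
Hypotheses (t_neq0 : t != 0) (qn_neq0 : forall i, 1 - t ^+ i.+1 != 0).
Hypotheses (char0 : forall i, i.+1%:R != 0 :> F).
Hypotheses (x_inj : injective x) (x_neq0 : forall i, x i != 0).
Implicit Types (y : 'I_n -> F) (u : ('I_n -> F) -> F) (D : {set 'I_n}) (l : seq nat).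

(** One [qfact] for each drop in the sequence [r], [l], 0. For column heights the drops are the
    multiplicities of the parts, whence [v_lamE]. *)
Fixpoint vseq (r : nat) l : F :=
  if l is s :: l' then qfact t (r - s) * vseq s l' else qfact t r.

(** If [D] is not contained in the final segment, its least element d lies outside it and neither
    set has elements below d, so the factor at d is 1 - 1 = 0. *)
Lemma colwt_lastset r D : colwt t (lastset n r) D = (D \subset lastset n r)%:R.
Proof.
case: (boolP (D \subset lastset n r)) => [Dr|/subsetPn[d0 d0D d0r]].
  rewrite /colwt big1 // => d _; rewrite /colfac; case: ifP => // /andP[dD].
  by rewrite (subsetP Dr).
pose d := [arg min_(d < d0 in D) (d : nat)]%N.
have [dD dmin] : d \in D /\ forall e, e \in D -> (d <= e)%N.
  by rewrite /d; case: arg_minnP.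
have dr : d \notin lastset n r by move: d0r; rewrite !inE; have := dmin _ d0D; lia.
rewrite /colwt (bigD1 d) //= /colfac dD dr /=.
have -> : below D d = 0%N.
  by apply: eq_card0 => e; rewrite !inE; case: (boolP (e \in D)) => // /dmin; lia.
have -> : below (lastset n r) d = 0%N.
  by apply: eq_card0 => e; move: dr; rewrite !inE; lia.
by rewrite !expr0 divr1 subrr mul0r.
Qed.

Lemma lastinv_xprod r s u : (s <= r)%N ->
  lastinv r u -> lastinv s (fun y => u y * xprod y (lastset n s)).
Proof.
move=> sr uinv i j y ij si; rewrite uinv ?(subsetP (lastsetS n sr)) //.
by rewrite xprod_tperm swapset_id //; move: si; rewrite !inE ij; lia.
Qed.

(** After [lastset n r] only subsets of it survive, each with weight 1. [symm_sort] moves them all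
    to [lastset n s] and [qsumE] evaluates the resulting sum of powers; [u] accumulates the
    monomials already extracted. *)
Lemma symm_colsum l u r : (r <= n)%N -> path geq r l -> lastinv r u ->
  vseq r l * symm t x (fun y => u y * colsum t l (lastset n r) y) =
  qfact t r * symm t x (fun y => u y * \prod_(s <- l) xprod y (lastset n s)).
Proof.
elim: l u r => [|s l IH] u r rn /=.
  by move=> _ _; congr (_ * _); apply: eq_symm => y; rewrite big_nil.
case/andP=> sr pl uinv.
have -> : symm t x (fun y => u y * \sum_(D : {set 'I_n} | #|D| == s)
      colwt t (lastset n r) D * xprod y D * colsum t l D y) =
    \sum_(D : {set 'I_n} | (D \subset lastset n r) && (#|D| == s))
       symm t x (fun y => u y * xprod y D * colsum t l D y).
  rewrite -symm_sum; apply: eq_symm => y; rewrite mulr_sumr big_mkcondl /=.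
  apply: eq_bigr => D _; rewrite colwt_lastset; case: ifP => _.
    by rewrite mul1r mulrA.
  by rewrite !mul0r mulr0.
set W := symm t x (fun y => u y * xprod y (lastset n s) * colsum t l (lastset n s) y).
have e : t ^+ wt (lastset n s) * \sum_(D : {set 'I_n} | (D \subset lastset n r) && (#|D| == s))
       symm t x (fun y => u y * xprod y D * colsum t l D y) = qsum n t r s * W.
  rewrite mulr_sumr /qsum mulr_suml; apply: eq_bigr => D /andP[Dr /eqP cD].
  by have := symm_sort t_neq0 x_inj l uinv Dr; rewrite cD.
have tw0 : t ^+ wt (lastset n s) != 0 by rewrite expf_neq0.
have sn : (s <= n)%N by apply: leq_trans sr rn.
have {IH} := IH (fun y => u y * xprod y (lastset n s)) s sn pl (lastinv_xprod sr uinv).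
rewrite -/W => IH.
have -> : symm t x (fun y => u y * \prod_(j <- s :: l) xprod y (lastset n j)) =
   symm t x (fun y => u y * xprod y (lastset n s) * \prod_(j <- l) xprod y (lastset n j)).
  by apply: eq_symm => y; rewrite big_cons mulrA.
apply: (mulfI tw0); rewrite mulrCA e mulrCA.
apply: (mulfI (qfact_neq0 qn_neq0 s)).
transitivity (qsum n t r s * qfact t s * qfact t (r - s) * (vseq s l * W)); first by ring.
by rewrite IH qsumE //; ring.
Qed.

(** The full column contains both members of every adjacent pair, so the first half of [colsum_swap]
    applies to each generator. *)
Lemma colsum_symmetric l y (w : 'S_n) : injective y ->
  colsum t l setT (fun a => y (w a)) = colsum t l setT y.
Proof.
move: w y; apply: adjacent_tperm_ind => [y yi|s w Hs Hw y yi|i j ij y yi].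
- by congr colsum; apply: functional_extensionality => a; rewrite perm1.
- rewrite -[RHS](Hw y yi) -[RHS]Hs => [|a b /yi/perm_inj//].
  by congr colsum; apply: functional_extensionality => a; rewrite permM.
have yij : y i != y j by apply: contra (neq_ij ij) => /eqP/yi ->.
by have [-> //] := colsum_swap t_neq0 ij l setT yij; rewrite !inE.
Qed.

(** For j >= 1 this is the j-th part of the conjugate partition, a column height; the value at 0 is
    [n]. *)
Definition parts_ge (lam : 'I_n -> nat) (j : nat) : nat := #|[set i | (j <= lam i)%N]|.

Definition colsizes (lam : 'I_n -> nat) (k : nat) : seq nat :=
  [seq parts_ge lam j.+1 | j <- iota 0 k].

Lemma parts_geS lam j : (parts_ge lam j.+1 <= parts_ge lam j)%N.
Proof. by apply: subset_leq_card; apply/subsetP=> i; rewrite !inE; apply: ltnW. Qed.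

Lemma parts_ge0 lam : parts_ge lam 0 = n.
Proof. by rewrite -[RHS]card_ord; apply: eq_card => i; rewrite !inE. Qed.

Lemma parts_geB lam j :
  (parts_ge lam j - parts_ge lam j.+1)%N = #|[set i | lam i == j]|.
Proof.
rewrite /parts_ge -(cardID [pred i | lam i == j] [set i | (j <= lam i)%N]).
rewrite (_ : #|[predD [set i | (j <= lam i)%N] & _]| = #|[set i | (j < lam i)%N]|).
  by rewrite addnK; apply: eq_card => i; rewrite !inE; lia.
by apply: eq_card => i; rewrite !inE; lia.
Qed.

Lemma path_colsizes lam m k :
  path geq (parts_ge lam m) [seq parts_ge lam j.+1 | j <- iota m k].
Proof. by elim: k m => //= k IH m; rewrite parts_geS IH. Qed.

Lemma vseq_colsizes lam m k :
  vseq (parts_ge lam m) [seq parts_ge lam j.+1 | j <- iota m k] =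
  (\prod_(j <- iota m k) qfact t #|[set i | lam i == j]|) * qfact t (parts_ge lam (m + k)).
Proof.
elim: k m => [|k IH] m /=; first by rewrite big_nil mul1r addn0.
by rewrite IH big_cons parts_geB addSnnS mulrA.
Qed.

Lemma lam1_ge (lam : 'I_n -> nat) i : (lam i <= lam1 lam)%N.
Proof. by rewrite /lam1 (leq_bigmax i). Qed.

Lemma v_lamE (lam : 'I_n -> nat) : v_lam lam t = vseq n (colsizes lam (lam1 lam)).
Proof.
rewrite -{1}[n in vseq n](parts_ge0 lam) vseq_colsizes /v_lam big_ord_recr /=.
rewrite prod_iota0 /qfact add0n; congr (_ * _).
suff -> : parts_ge lam (lam1 lam) = #|[set k | lam k == lam1 lam]| by [].
by apply: eq_card => i; rewrite !inE; have := lam1_ge lam i; lia.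
Qed.

(** As [lam] decreases, the indices with part exceeding [j] form an initial segment. *)
Lemma lt_parts_ge (lam : 'I_n -> nat) j (i : 'I_n) :
  nonincr lam -> (i < parts_ge lam j.+1)%N = (j < lam i)%N.
Proof.
move=> /forallP dec.
have {}dec (a b : 'I_n) : (a <= b)%N -> (lam b <= lam a)%N.
  by move=> ab; have /forallP/(_ b) := dec a; rewrite ab.
apply/idP/idP => [|jl].
  apply: contraLR; rewrite -!leqNgt => lj.
  rewrite -[X in (_ <= X)%N](card_ltn_ord (ltnW (ltn_ord i))).
  apply: subset_leq_card; apply/subsetP=> a; rewrite !inE ltnNge => aj.
  rewrite ltnNge; apply: contra aj => ia; exact: leq_trans (dec _ _ ia) lj.
rewrite -[X in (X <= _)%N](card_ltn_ord (ltn_ord i)); apply: subset_leq_card.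
apply/subsetP=> a; rewrite !inE ltnS.
by move=> /dec; apply: leq_trans.
Qed.

Lemma prod_xprod_colsizes (lam : 'I_n -> nat) k y : nonincr lam ->
  (forall i, lam i <= k)%N ->
  \prod_(s <- colsizes lam k) xprod y (lastset n s) = \prod_(i < n) y i ^+ lam (rev_ord i).
Proof.
move=> dec lk; rewrite /colsizes big_map.
under eq_bigr do rewrite /xprod big_mkcond /=.
rewrite exchange_big /=; apply: eq_bigr => i _.
rewrite prod_iota0.
rewrite -big_mkcond /= -[in RHS](card_ord (lam (rev_ord i))) -prodr_const.
rewrite (big_ord_widen k (fun=> y i) (lk (rev_ord i))); apply: eq_bigl => j.
by rewrite !inE -lt_parts_ge //=; have := ltn_ord i; lia.
Qed.

(** [symm_colsum] is applied with [u = 1], starting from the full column. That column sum is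
    symmetric, so it leaves the symmetrizer as a factor, and [symm1] provides the [qfact t n] that
    cancels. *)
Lemma HL_colsum (lam : 'I_n -> nat) : nonincr lam ->
  (v_lam lam t)^-1 *
  \sum_(w : 'S_n)
     ((\prod_(i < n) x (w i) ^+ lam i) *
      \prod_(i < n) \prod_(j < n | (i < j)%N)
         ((x (w i) - t * x (w j)) / (x (w i) - x (w j)))) =
  colsum t (colsizes lam (lam1 lam)) setT x.
Proof.
move=> dec; set l := colsizes _ _.
have pl : path geq n l by rewrite -[n in path _ n](parts_ge0 lam); apply: path_colsizes.
have := @symm_colsum l (fun=> 1) n (leqnn n) pl (fun _ _ _ _ _ => erefl).
rewrite -v_lamE lastset_full.
have -> : symm t x (fun y => 1 * colsum t l setT y) = qfact t n * colsum t l setT x.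
  rewrite -(symm1 qn_neq0 char0 x_inj x_neq0) /symm mulr_suml; apply: eq_bigr => w _.
  by rewrite mul1r mulr1 colsum_symmetric.
have v0 : v_lam lam t != 0.
  by apply/prodf_neq0 => m _; apply/prodf_neq0 => i _; apply: (qint_neq0 qn_neq0).
rewrite mulrCA => /(mulfI (qfact_neq0 qn_neq0 n)) e.
apply: (mulfI v0); rewrite mulVKf // e.
(* Reversing the positions turns [kernel] and the right-aligned monomial into those of [HL_P]. *)
pose rp := perm (@rev_ord_inj n).
rewrite /symm [RHS](reindex_inj (mulgI rp)) /=; apply: eq_bigr => w _.
rewrite mul1r prod_xprod_colsizes //; last by move=> i; apply: lam1_ge.
rewrite mulrC; congr (_ * _).
  rewrite /kernel pair_big_dep /=.
  rewrite (reindex_inj (h := fun p : 'I_n * 'I_n => (rev_ord p.1, rev_ord p.2))) /=; last first.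
    by move=> [a b] [c d] /= [e1 e2]; congr pair; apply: rev_ord_inj; apply: val_inj.
  apply: eq_big => [p|p _]; first by have := ltn_ord p.1; have := ltn_ord p.2; lia.
  by rewrite /hlratio !permM !permE.
rewrite (reindex_inj rev_ord_inj) /=; apply: eq_bigr => i _.
by rewrite permM permE.
Qed.

End Iterate.

(** * Grouping repeated columns *)

Lemma sum_tuple_cons (R : nmodType) (A : finType) l (P : pred (seq A)) (G : seq A -> R) :
  \sum_(T : l.+1.-tuple A | P T) G T =
  \sum_(a : A) \sum_(T : l.-tuple A | P (a :: T)) G (a :: T).
Proof.
rewrite pair_big_dep /=.
rewrite (reindex_onto (fun p : A * l.-tuple A => [tuple of p.1 :: p.2])
  (fun T => (thead T, [tuple of behead T]))) /=; last first.
  by move=> T _; rewrite [RHS]tuple_eta.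
apply: eq_bigl => -[a T]; rewrite theadE xpair_eqE eqxx /=.
by rewrite andbC (_ : _ == _) //; apply/eqP; apply: val_inj.
Qed.

Lemma sum_tuple0 (R : nmodType) (A : finType) (P : pred (seq A)) (G : seq A -> R) :
  \sum_(T : 0.-tuple A | P T) G T = if P [::] then G [::] else 0.
Proof.
rewrite big_mkcond (big_pred1 [tuple]) => [//|T].
by apply/esym/eqP; apply: tuple0.
Qed.

Lemma fps_fracE (R : comPzRingType) (a : R) k :
  fps_frac a k = if k == 0%N then 0 else a ^+ k.
Proof.
rewrite /fps_frac /fps_mul /fps_monX /fps_geom; case: k => [|k].
  by rewrite big_ord_recl big_ord0 /= mul0r addr0.
rewrite !big_ord_recl /= mul0r add0r subn1 /= -exprS big1 ?addr0 // => i _.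
by rewrite /bump /= mul0r.
Qed.

Section Grouping.
Variables (F : comPzRingType) (A : finType) (P : pred A) (phi : A -> A -> F) (z : A -> F).
Hypothesis phixx : forall C, phi C C = 1.
Implicit Types (C D : A) (T : seq A).

Fixpoint pathwt C T : F := if T is D :: T' then phi C D * pathwt D T' else 1.

Definition seqcoef T : fps F := \big[@fps_mul F/@fps_one F]_(C <- T) fps_frac (z C).

Lemma seqcoef_cons C T k :
  seqcoef (C :: T) k = \sum_(i < k) z C ^+ i.+1 * seqcoef T (k - i.+1)%N.
Proof.
rewrite /seqcoef big_cons {1}/fps_mul big_ord_recl fps_fracE mul0r add0r.
by apply: eq_bigr => i _; rewrite fps_fracE.
Qed.

Definition run_sum k C : F :=
  \sum_(T : k.-tuple A | all P T) pathwt C T * \prod_(D <- T) z D.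

(** [L] bounds the word length. By [seqcoef_small] a word longer than [k] contributes nothing, so
    [k < L] captures every word. *)
Definition reduced_sum L k C : F :=
  \sum_(l < L) \sum_(T : l.-tuple A | all P T && path (fun a b => a != b) C T)
    pathwt C T * seqcoef T k.

(* After the letter C: i more copies of C, then a word not starting with C. *)
Definition full_sum L k C : F := \sum_(i < k.+1) z C ^+ i * reduced_sum L (k - i)%N C.

Lemma run_sum0 C : run_sum 0 C = 1.
Proof.
rewrite /run_sum (sum_tuple0 (all P) (fun T => pathwt C T * \prod_(D <- T) z D)) /=.
by rewrite big_nil mulr1.
Qed.

Lemma run_sumS k C : run_sum k.+1 C = \sum_(D | P D) phi C D * z D * run_sum k D.
Proof.
rewrite /run_sum (sum_tuple_cons _ (all P) (fun T => pathwt C T * \prod_(D <- T) z D)).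
rewrite [RHS]big_mkcond; apply: eq_bigr => D _ /=; case: (P D) => /=; last by rewrite big_pred0.
by rewrite mulr_sumr; apply: eq_bigr => T _; rewrite big_cons; ring.
Qed.

Lemma reduced_sum_run L k D :
  \sum_(i < k) z D ^+ i.+1 * reduced_sum L (k - i.+1)%N D =
  \sum_(l < L) \sum_(T : l.-tuple A | all P T && path (fun a b => a != b) D T)
    pathwt D T * seqcoef (D :: T) k.
Proof.
under eq_bigr do rewrite /reduced_sum mulr_sumr.
rewrite exchange_big; apply: eq_bigr => l _ /=; under eq_bigr do rewrite mulr_sumr.
rewrite exchange_big; apply: eq_bigr => T _ /=.
by rewrite seqcoef_cons mulr_sumr; apply: eq_bigr => i _; ring.
Qed.

Lemma reduced_sumS L k C : reduced_sum L.+1 k C =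
  (k == 0%N)%:R + \sum_(D | P D && (C != D)) phi C D *
    \sum_(i < k) z D ^+ i.+1 * reduced_sum L (k - i.+1)%N D.
Proof.
rewrite {1}/reduced_sum big_ord_recl; congr (_ + _).
  rewrite (sum_tuple0 (fun T => all P T && path (fun a b => a != b) C T)
     (fun T => pathwt C T * seqcoef T k)) /= mul1r.
  by rewrite /seqcoef big_nil.
under [RHS]eq_bigr do rewrite reduced_sum_run mulr_sumr.
rewrite exchange_big; apply: eq_bigr => l _ /=.
rewrite (sum_tuple_cons _ (fun T => all P T && path (fun a b => a != b) C T)
     (fun T => pathwt C T * seqcoef T k)).
rewrite [RHS]big_mkcond; apply: eq_bigr => D _ /=.
case: (P D) => /=; last by rewrite big_pred0.
case: (C != D) => /=; last by rewrite big_pred0 // => T; rewrite andbF.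
by rewrite mulr_sumr; apply: eq_bigr => T _; ring.
Qed.

Lemma full_sum0 L C : full_sum L 0 C = reduced_sum L 0 C.
Proof. by rewrite /full_sum big_ord_recl big_ord0 addr0 mul1r subn0. Qed.

Lemma full_sumS L k C : full_sum L k.+1 C = reduced_sum L k.+1 C + z C * full_sum L k C.
Proof.
rewrite /full_sum big_ord_recl mul1r subn0 mulr_sumr; congr (_ + _).
by apply: eq_bigr => i _; rewrite exprS mulrA.
Qed.

Lemma full_sum_runs L k D :
  \sum_(i < k.+1) z D ^+ i.+1 * reduced_sum L (k.+1 - i.+1)%N D = z D * full_sum L k D.
Proof. by rewrite /full_sum mulr_sumr; apply: eq_bigr => i _; rewrite exprS mulrA. Qed.

(** Both sides satisfy one recursion in [k]: the next letter is [C] again, at no cost since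
    [phi C C = 1], or a different letter that opens a new run. *)
Lemma run_sum_full L k C : P C -> (k < L)%N -> run_sum k C = full_sum L k C.
Proof.
elim: k L C => [|k IH] [|L] C PC // kL.
  rewrite run_sum0 full_sum0 reduced_sumS eqxx big1 ?addr0 // => D _.
  by rewrite big_ord0 mulr0.
rewrite full_sumS reduced_sumS add0r -IH ?(ltnW kL) // run_sumS.
rewrite (bigD1 C) //= phixx mul1r addrC; congr (_ + _).
apply: eq_big => [D|D /andP[PD _]]; first by rewrite (eq_sym C).
by rewrite full_sum_runs -IH // mulrA.
Qed.

(** [C0] is a virtual letter before the word, which may itself begin with [C0]; hence [sorted]
    instead of [path]. *)
Lemma run_sum_reduced L k C0 : (forall D, phi C0 D = 1) -> (k < L)%N ->
  run_sum k C0 =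
  \sum_(l < L) \sum_(T : l.-tuple A | all P T && sorted (fun a b => a != b) T)
    pathwt C0 T * seqcoef T k.
Proof.
move=> phi0; case: L => // L kL; rewrite big_ord_recl.
rewrite (sum_tuple0 (fun T => all P T && sorted (fun a b => a != b) T)
     (fun T => pathwt C0 T * seqcoef T k)) /= mul1r.
rewrite (eq_bigr (fun l : 'I_L => \sum_(D | P D)
    \sum_(T : l.-tuple A | all P T && path (fun a b => a != b) D T)
      pathwt D T * seqcoef (D :: T) k)) => [|l _]; last first.
  rewrite (sum_tuple_cons _ (fun T => all P T && sorted (fun a b => a != b) T)
     (fun T => pathwt C0 T * seqcoef T k)).
  rewrite [RHS]big_mkcond; apply: eq_bigr => D _ /=.
  case: (P D) => /=; last by rewrite big_pred0.
  by apply: eq_bigr => T _; rewrite phi0 mul1r.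
rewrite exchange_big /=; under eq_bigr do rewrite -reduced_sum_run.
rewrite /seqcoef big_nil /fps_one; case: k kL => [|k] kL.
  by rewrite run_sum0 big1 ?addr0 // => D _; rewrite big_ord0.
rewrite add0r run_sumS; apply: eq_bigr => D PD.
by rewrite full_sum_runs -run_sum_full // phi0 mul1r.
Qed.

Lemma seqcoef_small T k : (k < size T)%N -> seqcoef T k = 0.
Proof.
elim: T k => // C T IH k kT; rewrite seqcoef_cons big1 // => i _.
by rewrite IH ?mulr0 //; move: kT (ltn_ord i) => /=; lia.
Qed.

End Grouping.

Lemma lt_nth_count (s : seq nat) r m : sorted geq s -> (r < size s)%N ->
  (m < nth 0%N s r)%N = (r < count (fun e => m < e)%N s)%N.
Proof.
have tr : transitive geq by move=> a b c /= ba ac; apply: leq_trans ac ba.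
elim: s r => //= a s IH r pa; have sa := path_sorted pa.
case: (ltnP m a) => am.
  by case: r => [|r] //= rs; rewrite IH.
have -> : count (fun e => m < e)%N s = 0%N.
  apply/eqP; rewrite -leqn0 leqNgt -has_count; apply/hasPn=> e es.
  have /allP/(_ e es) /= ae := order_path_min tr pa; rewrite -leqNgt; lia.
move=> rs; rewrite ltn0; apply/negbTE; rewrite -leqNgt; case: r rs => [//|r] /= rs.
have /allP/(_ _ (mem_nth 0%N rs)) /= := order_path_min tr pa; lia.
Qed.

(** * Tableaux, their shapes and the column weight *)

Section Tableaux.
Variables (F : fieldType) (n : nat) (t : F).
Hypothesis t_neq0 : t != 0.
Implicit Types (C D : {set 'I_n}) (T : seq {set 'I_n}) (x : 'I_n -> F) (l : seq nat).
Local Notation pathw := (pathwt (colwt t)).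

Lemma colsum_tuple l C x : colsum t l C x =
  \sum_(T : (size l).-tuple {set 'I_n} | [seq #|D| | D : {set 'I_n} <- T] == l)
    pathw C T * \prod_(D <- T) xprod x D.
Proof.
elim: l C => [|s l IH] C.
  rewrite (sum_tuple0 (fun T => [seq #|D| | D : {set 'I_n} <- T] == [::])
    (fun T => pathw C T * \prod_(D <- T) xprod x D)) /=.
  by rewrite big_nil mulr1.
rewrite (sum_tuple_cons _ (fun T => [seq #|D| | D : {set 'I_n} <- T] == s :: l)
    (fun T => pathw C T * \prod_(D <- T) xprod x D)) /=.
rewrite big_mkcond; apply: eq_bigr => D _; rewrite IH; under [RHS]eq_bigl do rewrite eqseq_cons.
case: (#|D| == s) => /=; last by rewrite big_pred0.
by rewrite mulr_sumr; apply: eq_bigr => T _; rewrite big_cons; ring.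
Qed.

Lemma pathwt_col_le C T : pathw C T != 0 -> path (@col_le n) C T.
Proof.
elim: T C => //= D T IH C; rewrite mulf_eq0 negb_or => /andP[/(colwt_col_le t_neq0) -> /IH ->] //.
Qed.

Lemma path_col_le_card C T : path (@col_le n) C T -> sorted geq [seq #|D| | D : {set 'I_n} <- T].
Proof.
move=> /path_sorted; rewrite sorted_map; apply: sub_sorted => D E /andP[] //.
Qed.

(** The columns increase for the partial order [col_le], so distinct neighbours make the chain
    strict. *)
Lemma pathwt_uniq C T : pathw C T != 0 -> uniq T = sorted (fun a b => a != b) T.
Proof.
move=> /pathwt_col_le/path_sorted le; apply/idP/idP => [|ne].
  by rewrite uniq_pairwise => /pairwise_sorted.
have : sorted [rel a b : {set 'I_n} | col_le a b && (a != b)] T.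
  by rewrite sorted_relI le.
apply: sorted_uniq => [b a c /= /andP[ab nab] /andP[bc nbc]|a /=]; last by rewrite eqxx andbF.
rewrite (col_le_trans ab bc); apply: contra nab => /eqP e; rewrite e in ab *.
by apply/eqP; apply: col_le_anti; rewrite bc ab.
Qed.

(** The shape of [T]: row [i] meets exactly the columns with more than [i] cells. [inord] loses
    nothing when [T] has [k] columns. *)
Definition multiplicity k T : {ffun 'I_n -> 'I_k.+1} :=
  [ffun i : 'I_n => inord (count (fun D : {set 'I_n} => i < #|D|)%N T)].

Lemma multiplicityE k T i : size T = k ->
  multiplicity k T i = count (fun D : {set 'I_n} => i < #|D|)%N T :> nat.
Proof. by move=> sT; rewrite ffunE inordK // ltnS -sT count_size. Qed.

Lemma multiplicity_nonincr k T : size T = k -> nonincr (fun i => val (multiplicity k T i)).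
Proof.
move=> sT; apply/forallP=> i; apply/forallP=> j; apply/implyP=> ij /=.
by rewrite !multiplicityE //; apply: sub_count => D /=; apply: leq_ltn_trans.
Qed.

Lemma lam1_multiplicity k T : size T = k -> all (fun C => C != set0) T ->
  lam1 (fun i => val (multiplicity k T i)) = k.
Proof.
move=> sT /allP T0; apply/eqP; rewrite eqn_leq; apply/andP; split.
  by apply/bigmax_leqP=> i _; rewrite -ltnS ltn_ord.
case: T sT T0 => [<-|C T sT T0] //.
have /set0Pn[i0 i0C] := T0 C (mem_head _ _).
have n0 : (0 < n)%N by apply: leq_ltn_trans (ltn_ord i0).
apply: leq_trans (lam1_ge _ (Ordinal n0)); rewrite [val _](multiplicityE _ sT) -{1}sT.
rewrite -[X in (X <= _)%N](count_predT) leq_eqVlt; apply/orP; left.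
by apply/eqP; apply: eq_in_count => D /T0 D0 /=; rewrite card_gt0.
Qed.

(** Conjugation of partitions: with decreasing heights, [i] is less than the height of column [j]
    iff [j] is less than the length of row [i]. That all [k] columns are nonempty reflects that the
    largest part is [k]. *)
Lemma multiplicity_colsizes k T (lam : {ffun 'I_n -> 'I_k.+1}) : size T = k ->
  sorted geq [seq #|D| | D : {set 'I_n} <- T] ->
  nonincr (fun i => val (lam i)) -> lam1 (fun i => val (lam i)) = k ->
  all (fun C => C != set0) T && (multiplicity k T == lam) =
  ([seq #|D| | D : {set 'I_n} <- T] == colsizes (fun i => val (lam i)) k).
Proof.
move=> sT sg dec l1; pose c := [seq #|D| | D : {set 'I_n} <- T].
have cnt i j : (j < k)%N ->
    (i < nth 0%N c j)%N = (j < count (fun D : {set 'I_n} => i < #|D|)%N T)%N.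
  by move=> jk; rewrite lt_nth_count ?size_map ?sT // count_map.
have cn j : (nth 0%N c j <= n)%N.
  case: (ltnP j k) => jk; last by rewrite nth_default // size_map sT.
  by rewrite (nth_map set0) ?sT // -[X in (_ <= X)%N](card_ord n) max_card.
apply/andP/eqP => [[T0 /eqP e]|e].
  apply: (@eq_from_nth _ 0%N) => [|j]; rewrite !size_map ?size_iota // sT => jk.
  rewrite -/c (nth_map 0%N) ?size_iota // nth_iota // add0n.
  rewrite -[LHS](card_ltn_ord (cn j)); apply: eq_card => i; rewrite !inE.
  by rewrite cnt // -e [val _](multiplicityE _ sT).
have cE j : (j < k)%N -> nth 0%N c j = parts_ge (fun i => val (lam i)) j.+1.
  by move=> jk; rewrite /c e (nth_map 0%N) ?size_iota // nth_iota.
split.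
  apply/(all_nthP set0) => j; rewrite sT => jk.
  have := cE j jk; rewrite (nth_map set0) ?sT // -card_gt0 => ->.
  rewrite lt0n; apply/negP=> /eqP p0.
  have : (lam1 (fun i => val (lam i)) <= j)%N.
    apply/bigmax_leqP=> i _; rewrite leqNgt; apply/negP=> ji.
    by have := card0_eq p0 i; rewrite !inE ji.
  by rewrite l1 leqNgt jk.
apply/eqP/ffunP=> i; apply: val_inj; rewrite /= multiplicityE //.
rewrite -[RHS](@card_ltn_ord k); last by rewrite -ltnS.
rewrite -[LHS](@card_ltn_ord k); last by rewrite -sT count_size.
apply: eq_card => j; rewrite !inE -cnt // cE //.
by rewrite (lt_parts_ge j i dec).
Qed.

Lemma sum_colsum k x :
  \sum_(lam : {ffun 'I_n -> 'I_k.+1} |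
      nonincr (fun i => val (lam i)) && (lam1 (fun i => val (lam i)) == k))
    colsum t (colsizes (fun i => val (lam i)) k) setT x =
  run_sum (fun C => C != set0) (colwt t) (xprod x) k setT.
Proof.
rewrite /run_sum (partition_big (fun T : k.-tuple {set 'I_n} => multiplicity k T)
  (fun lam => nonincr (fun i => val (lam i)) && (lam1 (fun i => val (lam i)) == k))) /=.
  apply: eq_bigr => lam /andP[dec /eqP l1]; rewrite colsum_tuple.
  rewrite (_ : size (colsizes (fun i => val (lam i)) k) = k); last by rewrite size_map size_iota.
  rewrite big_mkcond [RHS]big_mkcond; apply: eq_bigr => T _.
  (* Heights need to decrease only for words of nonzero weight; the others contribute 0 to both
     sums. *)
  have [->|/pathwt_col_le/path_col_le_card sg] := eqVneq (pathw setT T) 0.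
    by rewrite mul0r !if_same.
  by rewrite multiplicity_colsizes // size_tuple.
by move=> T T0; rewrite multiplicity_nonincr ?lam1_multiplicity ?size_tuple ?eqxx.
Qed.

Lemma is_SSYT_cons2 C D T :
  is_SSYT (C :: D :: T) = [&& C != set0, col_le C D & is_SSYT (D :: T)].
Proof.
rewrite /is_SSYT /= -[iota 1 _]/(iota (1 + 0) _) iotaDl all_map -!andbA.
by case: (C != set0) => //=; rewrite /col_le; do !bool_congr.
Qed.

Lemma PhiT_cons C T : PhiT (C :: T) t =
  \prod_(i < n | legp (C :: T) i 0 != set0) (1 - t ^+ #|legp (C :: T) i 0|) * PhiT T t.
Proof. by rewrite /PhiT big_ord_recl. Qed.

(** Extended by 0 to sequences that are not semistandard, [PhiT] is multiplicative over consecutive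
    columns, because [colwt] vanishes off [col_le]. *)
Lemma PhiT_path C T : all (fun D => D != set0) (C :: T) ->
  (if is_SSYT (C :: T) then PhiT (C :: T) t else 0) = pathw C T.
Proof.
elim: T C => [|D T IH] C /= /andP[C0 T0].
  rewrite /is_SSYT /= C0 /= PhiT_cons /PhiT big_ord0 mulr1 big_pred0 // => i.
  by rewrite /legp /in_T /= andbF eqxx.
rewrite is_SSYT_cons2 C0 -IH //=; have [CD|CD] := boolP (col_le C D); last first.
  by have /eqP-> := contraNT (@colwt_col_le _ _ _ t_neq0 C D) CD; rewrite mul0r.
case: (is_SSYT (D :: T)); last by rewrite mulr0.
by rewrite PhiT_cons -(prod_legset t_neq0 CD).
Qed.

Lemma PhiT_pathT T : all (fun D => D != set0) T ->
  (if is_SSYT T then PhiT T t else 0) = pathw setT T.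
Proof.
case: T => [_|C T T0]; first by rewrite /PhiT big_ord0.
by rewrite (PhiT_path T0) /= colwtT mul1r.
Qed.

Lemma sum_rSSYT k x :
  \sum_(l < (2 ^ n).+1) \sum_(T : l.-tuple {set 'I_n} | is_rSSYT (val T))
     PhiT (val T) t * seqcoef (xprod x) T k =
  run_sum (fun C => C != set0) (colwt t) (xprod x) k setT.
Proof.
pose G (l : nat) := \sum_(T : l.-tuple {set 'I_n} | all (fun D => D != set0) T &&
  sorted (fun a b => a != b) T) pathw setT T * seqcoef (xprod x) T k.
have GE (l : nat) : \sum_(T : l.-tuple {set 'I_n} | is_rSSYT (val T))
     PhiT (val T) t * seqcoef (xprod x) T k = G l.
  rewrite /G big_mkcond [RHS]big_mkcond; apply: eq_bigr => T _.
  have [T0|T0] := boolP (all _ (val T)); last by rewrite /is_rSSYT /is_SSYT (negbTE T0).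
  have e := PhiT_pathT T0; rewrite /is_rSSYT /=.
  have [w0|w0] := eqVneq (pathw setT T) 0.
    rewrite w0 mul0r if_same; move: e; rewrite w0.
    by case: (is_SSYT T) => //= ->; rewrite mul0r if_same.
  rewrite -(pathwt_uniq w0) -e; case: ifP e => //= _ e.
  by rewrite -e eqxx in w0.
under eq_bigr do rewrite GE.
(* The length bounds [k.+1] and [(2 ^ n).+1] are both raised to their maximum: longer words have no
   coefficient at [k] in the first case, and cannot have distinct columns in the second. *)
have ext N M : (forall l : nat, (N <= l)%N -> G l = 0) -> (N <= M)%N ->
    \sum_(l < M) G l = \sum_(l < N) G l.
  move=> G0 NM; rewrite (big_ord_widen M G NM) [RHS]big_mkcond.
  by apply: eq_bigr => l _; case: ltnP => // /G0.
rewrite (@run_sum_reduced _ _ _ _ _ (@colwtxx n F t) k.+1) //; last exact: colwtT.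
rewrite -(ext k.+1 (maxn k.+1 (2 ^ n).+1)) ?leq_maxl //; last first.
  move=> l kl; rewrite /G big1 // => T _.
  by rewrite seqcoef_small ?mulr0 // size_tuple.
rewrite -(ext (2 ^ n).+1 (maxn k.+1 (2 ^ n).+1)) ?leq_maxr // => l nl.
rewrite /G big1 // => T /andP[_ sT].
have [->|/pathwt_uniq] := eqVneq (pathw setT T) 0; first by rewrite mul0r.
rewrite sT => /card_uniqP cT; have := max_card (mem (val T)).
rewrite cT size_tuple -(cardsT {set 'I_n}) -powersetT card_powerset cardsT card_ord.
by lia.
Qed.

End Tableaux.

(** * Power series over the fraction field *)

Section PowerSeries.
Variable R : comNzRingType.
Implicit Types f g h : fps R.

(** Truncation to polynomials lets [fps_mul] inherit the ring laws. *)
Lemma fps_mul_poly f g k N : (k < N)%N ->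
  fps_mul f g k = (\poly_(i < N) f i * \poly_(i < N) g i)`_k.
Proof.
move=> kN; rewrite coefM; apply: eq_bigr => i _.
by rewrite !coef_poly !(leq_ltn_trans _ kN) ?leq_subr // -ltnS.
Qed.

Lemma fps_mulC : commutative (@fps_mul R).
Proof.
move=> f g; apply: functional_extensionality => k.
by rewrite !(@fps_mul_poly _ _ k k.+1) // mulrC.
Qed.

Lemma fps_mulA : associative (@fps_mul R).
Proof.
move=> f g h; apply: functional_extensionality => k.
pose P (u : fps R) : {poly R} := \poly_(i < k.+1) u i.
transitivity ((P f * (P g * P h))`_k).
  rewrite coefM; apply: eq_bigr => i _.
  by rewrite coef_poly ltn_ord (@fps_mul_poly _ _ _ k.+1) // ltnS leq_subr.
rewrite mulrA coefM; apply: eq_bigr => i _.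
by rewrite (@fps_mul_poly f g _ k.+1) // [in P h]/P coef_poly ltnS leq_subr.
Qed.

Lemma fps_mul1f : left_id (@fps_one R) (@fps_mul R).
Proof.
move=> f; apply: functional_extensionality => k.
rewrite /fps_mul big_ord_recl mul1r subn0 big1 ?addr0 // => i _.
by rewrite /fps_one mul0r.
Qed.

HB.instance Definition _ := Monoid.isComLaw.Build (fps R) (@fps_one R) (@fps_mul R)
  fps_mulA fps_mulC fps_mul1f.

Lemma fps_1m_geom (a : R) : fps_mul (fps_1m a) (fps_geom a) = @fps_one R.
Proof.
apply: functional_extensionality => -[|k].
  by rewrite /fps_mul big_ord_recl big_ord0 mul1r addr0.
rewrite /fps_mul !big_ord_recl mul1r subn0 big1 ?addr0 => [|i _].
  by rewrite /fps_geom /fps_1m /= subn1 /= exprS mulNr subrr.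
by rewrite mul0r.
Qed.

Lemma fps_mul_suml (I : finType) (P : pred I) (f : I -> fps R) g k :
  fps_mul (fun k => \sum_(i | P i) f i k) g k = \sum_(i | P i) fps_mul (f i) g k.
Proof. by rewrite /fps_mul exchange_big; apply: eq_bigr => j _; rewrite mulr_suml. Qed.

Lemma fps_mulZl (c : R) f g k : fps_mul (fun k => c * f k) g k = c * fps_mul f g k.
Proof. by rewrite /fps_mul mulr_sumr; apply: eq_bigr => j _; rewrite mulrA. Qed.

(** Denominators indexed by [T] join the monomials, those outside [T] cancel against [fps_1m], and
    the one at [i0] remains. *)
Lemma fps_frac_over_denominators (I : finType) (i0 : I) (z : I -> R) (T : seq I) :
  uniq T -> all (fun C => C != i0) T ->
  fps_mul
    (fps_mul (\big[@fps_mul R/@fps_one R]_(C <- T) fps_monX (z C))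
       (\big[@fps_mul R/@fps_one R]_(C | (C != i0) && (C \notin T)) fps_1m (z C)))
    (\big[@fps_mul R/@fps_one R]_C fps_geom (z C)) =
  fps_mul (\big[@fps_mul R/@fps_one R]_(C <- T) fps_frac (z C)) (fps_geom (z i0)).
Proof.
move=> uT /allP T0.
rewrite [X in fps_mul _ X = _](bigD1 i0) //= [X in fps_mul _ (fps_mul _ X) = _](bigID (mem T)) /=.
have -> : \big[@fps_mul R/@fps_one R]_(C | (C != i0) && (C \in T)) fps_geom (z C) =
    \big[@fps_mul R/@fps_one R]_(C <- T) fps_geom (z C).
  rewrite big_uniq //=; apply: eq_bigl => C.
  by case: (boolP (C \in T)) => [/T0 ->|]; rewrite ?andbF.
rewrite /fps_frac big_split /=.
set A := \big[_/_]_(C <- T) fps_monX _; set B := \big[_/_]_(C <- T) fps_geom _.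
set M := \big[_/_]_(C | _) fps_1m _; set N := \big[_/_]_(C | _) fps_geom _.
have MN : fps_mul M N = @fps_one R.
  by rewrite -big_split big1 // => C _; apply: fps_1m_geom.
rewrite [fps_mul (fps_geom _) _]Monoid.mulmCA Monoid.mulmACA.
by rewrite [X in _ X = _]Monoid.mulmCA /= MN [fps_mul _ (fps_one R)]fps_mulC fps_mul1f.
Qed.

End PowerSeries.

(** * Genericity of the variables and the identity of series *)

Section Generic.
Variable n : nat.

(** An integer point where [p] does not vanish certifies the genericity conditions below. *)
Lemma tofracK_neq0 (p : Zpoly n) (v : 'I_n.+1 -> int) : p.@[v] != 0 -> tofracK p != 0.
Proof.
rewrite /tofracK tofrac_eq0; by apply: contra => /eqP ->; rewrite meval0.
Qed.

Lemma varY_neq0 : varY n != 0.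
Proof. by apply: (@tofracK_neq0 _ (fun=> 1)); rewrite mevalXU. Qed.

Lemma varY_qn_neq0 i : 1 - varY n ^+ i.+1 != 0.
Proof.
rewrite (_ : 1 - _ = tofracK (1 - 'X_ord0 ^+ i.+1 : Zpoly n)); last first.
  by rewrite /tofracK rmorphB rmorph1 rmorphXn.
apply: (@tofracK_neq0 _ (fun=> 0)).
by rewrite mevalB meval1 rmorphXn /= mevalXU expr0n subr0.
Qed.

Lemma K_char0 i : i.+1%:R != 0 :> K n.
Proof.
rewrite (_ : i.+1%:R = tofracK (i.+1%:R : Zpoly n)); last by rewrite /tofracK rmorph_nat.
by apply: (@tofracK_neq0 _ (fun=> 0)); rewrite rmorph_nat pnatr_eq0.
Qed.

Lemma varx_neq0 i : @varx n i != 0.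
Proof. by apply: (@tofracK_neq0 _ (fun=> 1)); rewrite mevalXU. Qed.

Lemma varx_inj : injective (@varx n).
Proof.
move=> i j /eqP; rewrite -subr_eq0; apply: contraTeq => ij.
rewrite (_ : varx i - varx j = tofracK ('X_(lift ord0 i) - 'X_(lift ord0 j) : Zpoly n)).
  apply: (@tofracK_neq0 _ (fun a => (a == lift ord0 i)%:R)).
  by rewrite mevalB !mevalXU eqxx (inj_eq lift_inj) [j == i]eq_sym (negbTE ij) subr0.
by rewrite /tofracK rmorphB.
Qed.

Lemma HL_series_run_sum k :
  HL_series n k = run_sum (fun C => C != set0) (colwt (varY n)) (xprod (@varx n)) k setT.
Proof.
rewrite -(sum_colsum varY_neq0) /HL_series; apply: eq_bigr => lam /andP[dec /eqP l1].
rewrite -[X in colsizes _ X]l1 -(HL_colsum varY_neq0 varY_qn_neq0 K_char0 varx_inj varx_neq0) //.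
Qed.

Lemma HL_series_HLS k : HL_series n k = HLS_subst n k.
Proof. by rewrite HL_series_run_sum -(sum_rSSYT varY_neq0). Qed.

End Generic.

Theorem theoremE (n : nat) :
  (forall k : nat,
     fps_mul (H_n n) (fps_1m (1 : K n)) k = HLS_subst n k) /\
  (forall k : nat,
     H_n n k =
     fps_mul (Hnum n)
       (\big[@fps_mul (K n)/@fps_one (K n)]_(I : {set 'I_n}) fps_geom (xC I)) k).
Proof.
have HLS : HL_series n = HLS_subst n.
  by apply: functional_extensionality => k; apply: HL_series_HLS.
split=> k.
  rewrite /H_n (fps_mulC (fps_geom 1)) -fps_mulA (fps_mulC (fps_geom 1)) fps_1m_geom.
  by rewrite fps_mulC fps_mul1f HLS.
rewrite /H_n HLS fps_mulC /HLS_subst /Hnum.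
rewrite !fps_mul_suml; apply: eq_bigr => l _; rewrite !fps_mul_suml.
apply: eq_bigr => T /andP[/andP[T0 _] uT]; rewrite !fps_mulZl; congr (_ * _).
(* The empty set has [xC set0 = 1], so its denominator is the factor 1/(1 - X) of [H_n]. *)
rewrite (@fps_frac_over_denominators _ _ set0 (@xC n)) //.
by rewrite /xC big_set0.
Qed.
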